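(* Let $A$ be a finite set (with the discrete topology) and let $(\mathbf{w}_n)_{n\geq 1}$ be a sequence of words over $A$ with $|\mathbf{w}_n|\rightarrow\infty$. Then the following two statements are equivalent: (i) $\mathtt{ssd}(\mathbf{v},\mathbf{w}_n)$ converges as $n\rightarrow\infty$ for each word $\mathbf{v}$ over $A$. (ii) $\rho_{\mathbf{w}_n}$ converges weakly as $n\rightarrow\infty$ towards some $\rho\in\mathcal{C}(A)$. If (i) and (ii) hold, then $\lim_{n\rightarrow\infty}\mathtt{ssd}(\mathbf{v},\mathbf{w}_n)=\mathtt{IOS}(\rho,k)(\{\mathbf{v}\})$ for each $k\geq 1$ and $\mathbf{v}\in A^k$.
   Context: Words over $A$ are elements of $\bigcup_{n\ge1}A^n$; $|\mathbf{w}|$ is the length of $\mathbf{w}$; $[n]=\{1,\dots,n\}$; $\delta_x$ is the Dirac measure; $\mathcal{L}(X)$ is the law of $X$. $\mathcal{M}_1(A\times\mathbb{R})$ is the set of Borel probability measures on $A\times\mathbb{R}$ with the weak topology. For $k\le n$, $\mathbf{v}\in A^k$, $\mathbf{w}\in A^n$, let $\binom{\mathbf{w}}{\mathbf{v}}:=\#\{1\le j_1<\dots<j_k\le n: w_{j_i}=v_i\text{ for all }i\in[k]\}$, and define the subsequence density $\mathtt{ssd}(\mathbf{v},\mathbf{w}):=\binom{\mathbf{w}}{\mathbf{v}}\big/\binom{n}{k}$ (for fixed $\mathbf{v}$, $\mathtt{ssd}(\mathbf{v},\mathbf{w}_n)$ is defined for $n$ large). For $\mathbf{w}=(w_1,\dots,w_n)\in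 A^n$: $\rho_{\mathbf{w}}:=\frac1n\sum_{j=1}^n\delta_{(w_j,j/n)}\in\mathcal{M}_1(A\times\mathbb{R})$. $\mathcal{C}(A):=\{\rho\in\mathcal{M}_1(A\times\mathbb{R}):\rho(A\times[0,t])=t\text{ for all }t\in[0,1]\}$. For real $x_1,\dots,x_k$, let $\pi$ be the permutation of $[k]$ with $x_{\pi(1)}\le\dots\le x_{\pi(k)}$ sorting stably (equal values keep the order of their indices), and for $y_i\in A$ let $\mathtt{ios}(y_1,\dots,y_k,x_1,\dots,x_k):=(y_{\pi(1)},\dots,y_{\pi(k)})$. For $(Y_1,X_1),\dots,(Y_k,X_k)$ i.i.d. $\sim\rho$, $\mathtt{IOS}(\rho,k):=\mathcal{L}(\mathtt{ios}(Y_1,\dots,Y_k,X_1,\dots,X_k))\in\mathcal{M}_1(A^k)$. *)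

(* Defs.v *)
From HB Require Import structures.
From mathcomp Require Import all_boot all_order all_algebra.
From mathcomp Require Import all_classical all_reals all_analysis.

Set Implicit Arguments.
Unset Strict Implicit.
Unset Printing Implicit Defensive.

Import Order.TTheory GRing.Theory Num.Theory.
Import numFieldNormedType.Exports.

Local Open Scope classical_set_scope.
Local Open Scope ring_scope.

(* Words are the elements of the union of the A^n with n >= 1, hence nonempty. *)
Record word (A : Type) : Type :=
  Word { word_seq :> seq A; word_gt0 : (0 < size word_seq)%N }.

(* The number of strictly increasing index tuples j_1 < ... < j_k along which
   w reads v. *)
Definition subseq_count (A : finType) (v w : seq A) : nat :=
  #|[set j : {ffun 'I_(size v) -> 'I_(size w)} |
      [forall a : 'I_(size v), forall b : 'I_(size v),
         (a < b)%N ==> (j a < j b)%N] &&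
      [forall a, tnth (in_tuple w) (j a) == tnth (in_tuple v) a]]|.

(* The density is only meaningful when v is not longer than w; otherwise it is
   0 / 0 = 0. *)
Definition ssd (R : realType) (A : finType) (v w : seq A) : R :=
  (subseq_count v w)%:R / 'C(size w, size v)%:R.

(* The finite set A as a discrete topological space with the sigma-algebra of
   all its subsets.  The measurable types of the library are pointed: a0 only
   serves as the distinguished point, and exists as soon as there is a word. *)
Definition letter (A : finType) (a0 : A) : Type := A.

Section letter_instances.
Variables (A : finType) (a0 : A).
Local Notation L := (letter a0).

HB.instance Definition _ := Finite.copy L A.
HB.instance Definition _ := isPointed.Build L a0.
HB.instance Definition _ := hasNbhs.Build L principal_filter.
HB.instance Definition _ := Discrete_ofNbhs.Build L erefl.
HB.instance Definition _ := @isMeasurable.Build default_measure_display L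
  discrete_measurable discrete_measurable0
  discrete_measurableC discrete_measurableU.

End letter_instances.

Section empirical.
Variables (R : realType) (A : finType) (a0 : A) (w : word A).
Local Notation n := (size w).

(* nth is used in range only; positions are counted from 1. *)
Definition empirical : set (letter a0 * R) -> \bar R :=
  mscale (n%:R^-1)%:nng
    (msum (fun j : nat =>
       @dirac _ (letter a0 * R)%type
         (nth a0 w j : letter a0, j.+1%:R / n%:R : R) R) n).

HB.instance Definition _ := Measure.on empirical.

Let empirical_setT : empirical setT = 1%E.
Proof.
rewrite /empirical /mscale /= /msum.
rewrite (eq_bigr (fun=> 1%:E)); last by move=> i _; exact: diracT.
rewrite sumEFin sumr_const card_ord -EFinM mulVf//.
by rewrite pnatr_eq0 -lt0n; exact: word_gt0.
Qed.

HB.instance Definition _ :=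
  Measure_isProbability.Build _ _ _ empirical empirical_setT.

Definition rho_word : probability (letter a0 * R)%type R := empirical.

End empirical.

(* Continuity refers to the product of the discrete and the usual topology. *)
Definition weak_cvg (R : realType) (A : finType) (a0 : A)
    (mu : nat -> probability (letter a0 * R)%type R)
    (nu : probability (letter a0 * R)%type R) : Prop :=
  forall f : letter a0 * R -> R, continuous f -> bounded_fun f ->
    (\int[mu n]_x (f x)%:E @[n --> \oo] --> \int[nu]_x (f x)%:E)%E.

Definition calC (R : realType) (A : finType) (a0 : A) :
    set (probability (letter a0 * R)%type R) :=
  [set rho | forall t : R, 0 <= t <= 1 ->
     rho ([set: letter a0] `*` `[0, t]) = t%:E].

Section iid.
Context d (T : measurableType d) (R : realType).

Definition cons_pair k (p : T * k.-tuple T) : k.+1.-tuple T :=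
  [tuple of p.1 :: p.2].

Lemma measurable_cons_pair k : measurable_fun setT (@cons_pair k).
Proof. exact: measurable_cons. Qed.

HB.instance Definition _ k :=
  isMeasurableFun.Build _ _ _ _ (@cons_pair k) (@measurable_cons_pair k).

(* The k-fold product measure, i.e. the joint law of k independent random
   variables with law P. *)
Fixpoint iid (P : probability T R) k : probability (k.-tuple T) R :=
  match k with
  | 0 => @dirac _ (0.-tuple T) [tuple] R
  | k'.+1 => distribution (P \x iid P k')%E (@cons_pair k')
  end.

End iid.

Section ios.
Variables (R : realType) (A : finType) (a0 : A) (k : nat).
Local Notation T := (letter a0 * R)%type.

(* The letters listed by increasing real coordinate; sort is stable, so ties
   keep the order of their indices. *)
Definition ios (s : k.-tuple T) : k.-tuple (letter a0) :=
  [tuple of map fst (sort (fun p q : T => p.2 <= q.2) s)].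

(* ios factors through finitely many measurable tests: the comparisons of the
   second components and the values of the first ones. *)
Let code : finType := ({ffun 'I_k * 'I_k -> bool} * k.-tuple A)%type.

Let encode (s : k.-tuple T) : code :=
  ([ffun p => (tnth s p.1).2 <= (tnth s p.2).2], [tuple of map fst s]).

Let decode (c : code) : seq A :=
  map (tnth c.2) (sort (fun i j => c.1 (i, j)) (enum 'I_k)).

Let iosE s : ios s = decode (encode s) :> seq A.
Proof.
rewrite /ios /decode [LHS]/=.
rewrite -[X in sort _ X]map_tnth_enum sort_map -map_comp.
have -> : sort (relpre (tnth s) (fun p q : T => p.2 <= q.2)) (enum 'I_k) =
          sort (fun i j => (encode s).1 (i, j)) (enum 'I_k).
  by congr (sort _ _); apply/funext => i; apply/funext => j; rewrite ffunE.
by apply: eq_map => i /=; rewrite tnth_map.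
Qed.

Let measurable_le i j :
  measurable [set s : k.-tuple T | (tnth s i).2 <= (tnth s j).2].
Proof.
have m2 l : measurable_fun setT (fun s : k.-tuple T => (tnth s l).2).
  by apply: measurableT_comp => //; exact: measurable_tnth.
by have := measurable_fun_le measurableT (m2 i) (m2 j); rewrite setTI.
Qed.

Let measurable_fst_eq i (a : A) :
  measurable [set s : k.-tuple T | (tnth s i).1 = a].
Proof.
have m1 : measurable_fun setT (fun s : k.-tuple T => (tnth s i).1).
  by apply: measurableT_comp => //; exact: measurable_tnth.
by have := m1 measurableT [set a] I; rewrite setTI.
Qed.

Let measurable_encode (c : code) : measurable [set s | encode s = c].
Proof.
have -> : [set s | encode s = c] =
    (\bigcap_(p in [set: 'I_k * 'I_k])
       [set s : k.-tuple T | ((tnth s p.1).2 <= (tnth s p.2).2) = c.1 p]) `&`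
    (\bigcap_(i in [set: 'I_k]) [set s | (tnth s i).1 = tnth c.2 i]).
  apply/seteqP; split=> [s <-|s [sc1 sc2]] /=.
    by split=> [p _|i _] /=; rewrite ?ffunE ?tnth_map.
  case: c sc1 sc2 => c1 c2 sc1 sc2; congr pair.
    by apply/ffunP => p; rewrite ffunE; exact: sc1.
  by apply: eq_from_tnth => i; rewrite tnth_map; exact: sc2.
apply: measurableI; last first.
  by apply: fin_bigcap_measurable => // i _; exact: measurable_fst_eq.
apply: fin_bigcap_measurable => // p _; case: (c.1 p).
  exact: measurable_le.
rewrite (_ : [set _ | _] =
  ~` [set s : k.-tuple T | (tnth s p.1).2 <= (tnth s p.2).2]); last first.
  by apply/seteqP; split=> s /=; [move=> -> | move/negP/negbTE].
by apply: measurableC; exact: measurable_le.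
Qed.

Lemma measurable_ios : measurable_fun setT ios.
Proof.
move=> _ Y _; rewrite setTI.
have -> : ios @^-1` Y = \bigcup_(c in [set c : code |
    exists2 y, Y y & tval y = decode c]) [set s | encode s = c].
  apply/seteqP; split=> [s Ys|s [c [y Yy yc] /= sc]] /=.
    by exists (encode s) => //; exists (ios s) => //; exact: iosE.
  by rewrite (_ : ios s = y)//; apply: val_inj => /=; rewrite yc -sc iosE.
by apply: fin_bigcup_measurable => // c _; exact: measurable_encode.
Qed.

HB.instance Definition _ := isMeasurableFun.Build _ _ _ _ ios measurable_ios.

Definition IOS (rho : probability T R) : probability (k.-tuple (letter a0)) R :=
  distribution (iid rho k) ios.

End ios.

(* Main.v *)
From HB Require Import structures.
Require Import Defs.
From mathcomp Require Import all_boot all_order all_algebra.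
From mathcomp Require Import all_classical all_reals all_analysis.
From mathcomp Require Import measurable_realfun.
From mathcomp Require Import ring lra zify.
Import Order.TTheory GRing.Theory Num.Theory.
Import numFieldNormedType.Exports.
Local Open Scope classical_set_scope.
Local Open Scope ring_scope.
Set Implicit Arguments.
Unset Strict Implicit.
Unset Printing Implicit Defensive.

(** Both the densities of the words [w n] and the law [IOS k rho] are compared
with the same finite expression, and the empirical measures are identified
through one distribution function per letter.

Cut the unit interval into [M.+1] cells of equal length. If the points of an
i.i.d. sample of size [k] fall into distinct cells, the word they induce is
determined by the cells, and the probability that this happens and that the word
is [v] is [k`!] times the sum, over the increasing sequences of cells, of the
products of the masses that the measure gives to the pairs (letter of [v],
cell). This is [grid_ios]; [IOS_sandwich] bounds its distance to [IOS k rho [set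
v]] by the probability that two points share a cell. If all cells have mass
[M.+1%:R^-1], that probability is [1 - ffact_ratio R M.+1 k], which tends to [0]
as [M] grows. For the empirical measure of a word of length [N], cut into [N]
cells, and for [k <= N], [grid_ios] is [ssd] times [ffact_ratio R N k]
([grid_ios_word_tuple]), because both count the increasing positions at which
[v] is read. Hence [ssd v w] and the [IOS] law of the empirical measure of [w]
are close as soon as [w] is long.

For a fixed [M], [grid_ios] is a polynomial in the masses of the cells, which
are increments of the functions [letter_cdf rho a t], the mass of the letter [a]
on the half-line up to [t]. When these converge on the unit interval, so do the
densities, to the [IOS] law of the limit ([ssd_cvg]). For a limit in [calC],
this convergence is equivalent to weak convergence: one direction tests
trapezoids ([weak_cdf_cvg]), the other replaces a continuous function by its
values on the grid ([cdf_weak_cvg]).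

It remains to recover the distribution functions from the densities. Summing the
densities over the words of length [k.+1] that start with [a] and dividing by
[k.+1%:R] gives, up to a vanishing error, the moment of order [k] of [1 - x]
under the part of the empirical measure carried by [a] ([word_moment]). So the
integrals of all polynomials converge. Bernstein polynomials of a step function
approximate it away from the step, and few positions are close to the step since
they are equally spaced; so the distribution functions converge
([letter_cdf_is_cvg]). Their limits are nondecreasing and 1-Lipschitz, and the
sum of the associated Lebesgue-Stieltjes measures, one on each copy of the line,
is the limit measure ([exists_cdf_limit]). *)

(** * Limits through approximation *)

Section approximation.
Variable R : realType.

Lemma approx_cvg (f : nat -> R) (l : R) :
  (forall e, 0 < e -> exists (g : nat -> R) (L : R),
     [/\ g n @[n --> \oo] --> L, `|L - l| <= e &
         \forall n \near \oo, `|f n - g n| <= e]) ->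
  f n @[n --> \oo] --> l.
Proof.
move=> H; apply/cvgrPdist_le => e e0.
have e3 : 0 < e / 3 by rewrite divr_gt0.
have [g [L [/cvgrPdist_le/(_ _ e3) gL Ll fg]]] := H _ e3.
near=> n.
have : `|L - g n| <= e / 3 by near: n.
have : `|f n - g n| <= e / 3 by near: n.
move: Ll; rewrite !ler_norml => /andP[? ?] /andP[? ?] /andP[? ?].
by apply/andP; split; lra.
Unshelve. all: by end_near. Qed.

(** Completeness of the reals: being uniformly close to convergent sequences, up
to any precision, makes a sequence Cauchy. *)
Lemma approx_is_cvg (f : nat -> R) :
  (forall e, 0 < e -> exists g : nat -> R,
     cvgn g /\ \forall n \near \oo, `|f n - g n| <= e) ->
  cvg (f n @[n --> \oo]).
Proof.
move=> H; apply/cauchy_cvgP/cauchy_exP => e e0.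
have e3 : 0 < e / 3 by rewrite divr_gt0.
have [g [/cvg_ex[L /cvgrPdist_le/(_ _ e3) gL] fg]] := H _ e3.
exists L; suff: \forall n \near \oo, ball L e (f n) by [].
near=> n; rewrite /ball/=.
have : `|L - g n| <= e / 3 by near: n.
have : `|f n - g n| <= e / 3 by near: n.
move: e0; rewrite !ler_norml ltr_norml => e0 /andP[? ?] /andP[? ?].
by apply/andP; split; lra.
Unshelve. all: by end_near. Qed.

End approximation.

(** * Finitely many observations of an i.i.d. sample *)

Lemma measure_fin_pred d (T : measurableType d) (R : realType)
    (mu : {measure set T -> \bar R}) (I : finType) (f : T -> I) (P : pred I) :
  (forall i, measurable (f @^-1` [set i])) ->
  mu [set x | P (f x)] = (\sum_(i | P i) mu (f @^-1` [set i]))%E.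
Proof.
move=> mf; rewrite (_ : [set x | P (f x)] =
    \bigcup_(i in [set` P]) (f @^-1` [set i])); last first.
  apply/seteqP; split => [x Px|x [i /= Pi fi]]; first by exists (f x).
  by rewrite /= fi.
rewrite measure_fin_bigcup//; last first.
- by move=> i j Pi Pj [x [/= fi fj]]; rewrite -fi -fj.
rewrite [RHS]bigfs ?index_enum_uniq// => i _.
by rewrite mem_index_enum.
Qed.

Section finite_observation.
Context d (T : measurableType d) (R : realType) (mu : probability T R).
Variables (Q : finType) (q : T -> Q).
Hypothesis mq : forall z, measurable (q @^-1` [set z]).

Definition cell_mass (z : Q) : R := fine (mu (q @^-1` [set z])).

Lemma cell_massE z : mu (q @^-1` [set z]) = (cell_mass z)%:E.
Proof. by rewrite /cell_mass fineK// fin_num_measure. Qed.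

Lemma measurable_map_eq k (g : k.-tuple Q) :
  measurable [set s : k.-tuple T | map q s = g].
Proof.
have -> : [set s : k.-tuple T | map q s = g] = \bigcap_(i in [set: 'I_k])
    ((fun s : k.-tuple T => tnth s i) @^-1` (q @^-1` [set tnth g i])).
  apply/seteqP; split => [s /= sg i _ /=|s sg /=]; last first.
    have -> // : g = [tuple of map q s].
    by apply: eq_from_tnth => i; rewrite tnth_map sg.
  have -> : g = [tuple of map q s] by apply: val_inj; rewrite /= sg.
  by rewrite tnth_map.
apply: fin_bigcap_measurable => // i _.
by rewrite -[X in measurable X]setTI; apply: measurable_tnth.
Qed.

Lemma iid_map_eq k (g : k.-tuple Q) :
  iid mu k [set s : k.-tuple T | map q s = g] =
  (\prod_(z <- g) cell_mass z)%:E.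
Proof.
elim: k g => [|k IH] g.
  by rewrite tuple0 big_nil /= diracE mem_set.
case/tupleP: g => z g; rewrite big_cons.
rewrite /= /distribution /pushforward.
rewrite [X in (mu \x iid mu k)%E X](_ : _ =
    (q @^-1` [set z]) `*` [set s : k.-tuple T | map q s = g]); last first.
  apply/seteqP; split => [[x s] /= [-> ->]//|[x s] /= [-> ->]//].
rewrite product_measure1E//; last exact: measurable_map_eq.
by rewrite EFinM -cell_massE -IH.
Qed.

(** The law of a sample enters the proof only through these finite sums, whose
terms do not depend on the order of the points. *)
Lemma iid_map_pred k (P : pred (k.-tuple Q)) :
  iid mu k [set s : k.-tuple T | P [tuple of map q s]] =
  (\sum_(g : k.-tuple Q | P g) \prod_(z <- g) cell_mass z)%:E.
Proof.
have E (g : k.-tuple Q) :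
    (fun s : k.-tuple T => [tuple of map q s]) @^-1` [set g] =
    [set s : k.-tuple T | map q s = g].
  apply/seteqP; split => s /=; first by move=> <-.
  by move=> sg; apply: val_inj.
rewrite (measure_fin_pred _ (f := fun s : k.-tuple T => [tuple of map q s])).
  by rewrite -sumEFin; apply: eq_bigr => g _; rewrite E; exact: iid_map_eq.
by move=> g; rewrite E; exact: measurable_map_eq.
Qed.

End finite_observation.

(** * Sorting tuples of cells *)

Lemma card_perm_eq_tuple (Q : finType) k (h : k.-tuple Q) : uniq h ->
  #|[pred g : k.-tuple Q | perm_eq g h]| = k`!.
Proof.
move=> uh; rewrite -[in RHS](size_tuple h) -size_permutations// cardE.
rewrite -(size_map val); apply/perm_size/uniq_perm.
- by rewrite map_inj_uniq ?enum_uniq//; exact: val_inj.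
- exact: permutations_uniq.
move=> s; rewrite mem_permutations; apply/mapP/idP.
  by case=> g; rewrite mem_enum inE => gh ->.
move=> sh; have ss : size s == k by rewrite (perm_size sh) size_tuple.
by exists (Tuple ss) => //; rewrite mem_enum inE.
Qed.

Section ordered_cells.
Variables (A : finType) (M : nat).
Local Notation Q := (A * 'I_M)%type.

Definition cell_index (z : Q) : nat := z.2.

Definition increasing (g : seq Q) := sorted ltn (map cell_index g).

Definition sort_cells := sort (relpre cell_index leq).

Let increasingE g : increasing g = sorted (relpre cell_index ltn) g.
Proof. exact: sorted_map. Qed.

Lemma increasing_sort g : uniq (map cell_index g) -> increasing (sort_cells g).
Proof.
move=> ug; rewrite /increasing ltn_sorted_uniq_leq sorted_map.
rewrite sort_sorted ?andbT; last by move=> x y; exact: leq_total.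
by rewrite (perm_uniq (perm_map _ (permEl (perm_sort _ _)))).
Qed.

Lemma increasing_perm_eq g h : increasing g -> increasing h -> perm_eq g h ->
  g = h.
Proof.
rewrite !increasingE => ig ih /perm_mem gh.
apply: (@irr_sorted_eq _ (relpre cell_index ltn)) => //.
  by move=> y x z /=; exact: ltn_trans.
by move=> x /=; rewrite ltnn.
Qed.

Lemma increasing_uniq g : increasing g -> uniq (map cell_index g).
Proof. by rewrite /increasing ltn_sorted_uniq_leq => /andP[]. Qed.

(** Grouping the tuples with distinct positions by their sorted version: each
class has [k`!] members, and a product of masses is constant on a class. *)
Lemma sum_sort_cells (R : realType) (m : Q -> R) k (P : pred (seq Q)) :
  \sum_(g : k.-tuple Q | uniq (map cell_index g) && P (sort_cells g))
     \prod_(z <- g) m z =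
  k`!%:R * \sum_(h : k.-tuple Q | increasing h && P h) \prod_(z <- h) m z.
Proof.
rewrite (partition_big (fun g : k.-tuple Q => [tuple of sort_cells g])
  (fun h : k.-tuple Q => increasing h && P h)); last first.
  by move=> g /andP[ug Pg] /=; rewrite increasing_sort.
rewrite big_distrr/=; apply: eq_bigr => h /andP[ih Ph].
rewrite (eq_bigl (fun g : k.-tuple Q => perm_eq g h)); last first.
  move=> g /=; apply/idP/idP => [/andP[_ /eqP <-]|gh].
    by rewrite perm_sym perm_sort.
  have ug : uniq (map cell_index g).
    by rewrite (perm_uniq (perm_map _ gh)) increasing_uniq.
  have gh' : sort_cells g = h.
    apply: increasing_perm_eq => //; first exact: increasing_sort.
    by rewrite perm_sort.
  by rewrite ug [in P _]gh' Ph; apply/eqP/val_inj.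
rewrite (eq_bigr (fun=> \prod_(z <- h) m z)); last first.
  by move=> g gh; exact: perm_big.
rewrite sumr_const card_perm_eq_tuple ?mulr_natl//.
exact: map_uniq (increasing_uniq ih).
Qed.

Section cells_of_line.
Variables (R : realType) (a0 : A) (c : R -> 'I_M).
Hypothesis c_homo : {homo c : x y / x <= y >-> (x <= y)%N}.
Local Notation T := (letter a0 * R)%type.

Definition cell (p : T) : Q := (p.1, c p.2).

(** Replacing the points by the indices of their cells is nondecreasing, so
points in distinct cells are sorted in the same order as their cells. *)
Lemma ios_sort_cells k (s : k.-tuple T) : uniq (map cell_index (map cell s)) ->
  ios s = map fst (sort_cells (map cell s)) :> seq A.
Proof.
move=> us; rewrite /ios [LHS]/=; set s' := sort _ _.
have ps : perm_eq s' s by rewrite perm_sort.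
rewrite (_ : sort_cells _ = map cell s'); first by rewrite -map_comp.
apply: increasing_perm_eq; first exact: increasing_sort.
  rewrite /increasing ltn_sorted_uniq_leq.
  rewrite (perm_uniq (perm_map _ (perm_map _ ps))) us/= -map_comp sorted_map.
  have : sorted (fun p q : T => p.2 <= q.2) s'.
    by apply: sort_sorted => p r; exact: le_total.
  by apply: sub_sorted => p r /= /c_homo.
by rewrite perm_sort perm_sym perm_map.
Qed.
End cells_of_line.
End ordered_cells.

(** * The sandwich between cells and the induced order *)

Section grid.
Variables (R : realType) (M : nat).

(** Number of interior grid points strictly to the left of [x].  Points left of
the unit interval fall into the first cell and points right of it into the
last one, so that the cells cover the line and the index is monotone. *)
Definition grid_count (x : R) : nat :=
  #|[pred i : 'I_M | i.+1%:R / M.+1%:R < x]|.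

Lemma grid_count_le x : (grid_count x < M.+1)%N.
Proof. by rewrite ltnS -[X in (_ <= X)%N]card_ord max_card. Qed.

Definition grid_index (x : R) : 'I_M.+1 := inord (grid_count x).

Lemma grid_indexE x : grid_index x = grid_count x :> nat.
Proof. by rewrite inordK// grid_count_le. Qed.

Lemma grid_index_gt (x : R) (i : nat) : (i < M)%N ->
  (i < grid_index x)%N = (i.+1%:R / M.+1%:R < x).
Proof.
move=> iM; rewrite grid_indexE /grid_count.
have winj n (nM : (n <= M)%N) : injective (widen_ord nM).
  by move=> a b [/val_inj].
apply/idP/idP => [ix|ix].
  rewrite ltNge; apply: contraTN ix => xi; rewrite -leqNgt.
  rewrite -[X in (_ <= X)%N]card_ord.
  rewrite -(fintype.card_image (winj i (ltnW iM))).
  apply: subset_leq_card; apply/fintype.subsetP => j; rewrite inE => jx.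
  have ji : (j < i)%N.
    rewrite ltnNge; apply: contraTN jx => ij; rewrite -leNgt.
    by rewrite (le_trans xi)// ler_pM2r ?invr_gt0 ?ltr0n// ler_nat ltnS.
  apply/fintype.imageP; exists (Ordinal ji) => //.
  exact: val_inj.
rewrite -[X in (X <= _)%N]card_ord.
rewrite -(fintype.card_image (winj _ iM)).
apply: subset_leq_card; apply/fintype.subsetP => j /fintype.imageP[l _ ->].
rewrite inE /= (le_lt_trans _ ix)// ler_pM2r ?invr_gt0 ?ltr0n//.
by rewrite ler_nat ltn_ord.
Qed.

Lemma grid_index_homo : {homo grid_index : x y / x <= y >-> (x <= y)%N}.
Proof.
move=> x y xy; rewrite !grid_indexE; apply: subset_leq_card; apply/fintype.subsetP => j.
by rewrite !inE => /lt_le_trans; apply.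
Qed.

Lemma measurable_grid_index_gt i : measurable [set x | (i < grid_index x)%N].
Proof.
have [iM|Mi] := ltnP i M.
  rewrite (_ : [set _ | _] = `]i.+1%:R / M.+1%:R, +oo[%classic)//.
  by apply/seteqP; split => x /=; rewrite in_itv/= andbT grid_index_gt.
rewrite (_ : [set _ | _] = set0)//; apply/seteqP; split => x //=.
move=> /(leq_ltn_trans Mi) h.
by have := ltn_ord (grid_index x); rewrite ltnS leqNgt h.
Qed.

Lemma measurable_grid_index i : measurable (grid_index @^-1` [set i]).
Proof.
have -> : grid_index @^-1` [set i] =
    ~` [set x | (i < grid_index x)%N] `\` ~` [set x | (i < (grid_index x).+1)%N].
  apply/seteqP; split => x /=.
    by move=> ->; split; rewrite ?ltnn ?ltnS// => /negP; rewrite leqnn.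
  by move=> [/negP + /contrapT]; rewrite -leqNgt ltnS => xi ix;
    apply: val_inj; apply/eqP; rewrite eqn_leq xi ix.
apply: measurableD; apply: measurableC; first exact: measurable_grid_index_gt.
case: (nat_of_ord i) => [|j].
  rewrite (_ : [set _ | _] = setT)//; exact/seteqP.
exact: measurable_grid_index_gt.
Qed.

End grid.

Section sandwich.
Variables (R : realType) (A : finType) (a0 : A) (M : nat).
Local Notation T := (letter a0 * R)%type.
Local Notation Q := (A * 'I_M.+1)%type.
Implicit Types (rho : probability T R).

Definition grid_cell : T -> Q := cell (a0 := a0) (@grid_index R M).

Definition strip (i : 'I_M.+1) : set T := [set p | grid_index M p.2 = i].

Lemma measurable_strip i : measurable (strip i).
Proof.
rewrite (_ : strip i = setT `*` (@grid_index R M @^-1` [set i])).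
  by apply: measurableX => //; exact: measurable_grid_index.
by apply/seteqP; split => -[b x] //= [].
Qed.

Lemma grid_cellE z : grid_cell @^-1` [set z] =
  [set z.1 : letter a0] `*` (@grid_index R M @^-1` [set z.2]).
Proof.
by case: z => a i; apply/seteqP; split => -[b x]/=; rewrite /grid_cell/cell/=;
  [case=> <- <- | case=> <- <-].
Qed.

Lemma measurable_grid_cell z : measurable (grid_cell @^-1` [set z]).
Proof.
rewrite grid_cellE; apply: measurableX => //; exact: measurable_grid_index.
Qed.

Definition grid_mass rho : Q -> R := cell_mass rho grid_cell.

(** Probability that the points of a sample fall into distinct cells. *)
Definition distinct_mass rho k :=
  \sum_(g : k.-tuple Q | uniq (map (@cell_index A M.+1) g))
    \prod_(z <- g) grid_mass rho z.

(** Probability that the points of a sample fall into distinct cells and induce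
the word [v]. *)
Definition grid_ios rho k (v : k.-tuple A) :=
  k`!%:R * \sum_(h : k.-tuple Q | increasing h && (map fst h == v))
    \prod_(z <- h) grid_mass rho z.

Lemma IOS_sandwich rho k (v : k.-tuple A) :
  grid_ios rho v <= fine (IOS k rho [set v]) <=
  grid_ios rho v + (1 - distinct_mass rho k).
Proof.
pose U (g : k.-tuple Q) := uniq (map (@cell_index A M.+1) g).
pose V (g : k.-tuple Q) := map fst (sort_cells g) == v.
have iosU (s : k.-tuple T) : U [tuple of map grid_cell s] ->
    (ios s = v) <-> V [tuple of map grid_cell s].
  move=> Us; rewrite /V /= -(@ios_sort_cells _ _ _ _ (@grid_index R M))//.
    by split=> [->//|/eqP/val_inj].
  exact: grid_index_homo.
have mP P := @iid_map_pred _ _ _ rho _ _ measurable_grid_cell k P.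
have meas (P : pred (k.-tuple Q)) :
    measurable [set s : k.-tuple T | P [tuple of map grid_cell s]].
  rewrite (_ : [set _ | _] = \bigcup_(g in [set` P])
      [set s : k.-tuple T | map grid_cell s = g]).
    apply: fin_bigcup_measurable => // g _.
    exact: (measurable_map_eq measurable_grid_cell).
  apply/seteqP; split => [s Ps|s [g /= Pg sg]].
    by exists [tuple of map grid_cell s].
  by rewrite (_ : [tuple of _] = g)//; exact: val_inj.
have mv : measurable [set s : k.-tuple T | ios s = v].
  have mv' : measurable [set t : k.-tuple (letter a0) | t = v].
    have := @measurable_map_eq _ (letter a0) A id (fun=> I) k v.
    congr measurable; apply/seteqP; split => t /=; rewrite map_id.
      by move/val_inj.
    by move=> ->.
  have := @measurable_ios R A a0 k measurableT _ mv'.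
  by rewrite setTI.
have E1 : IOS k rho [set v] = iid rho k [set s : k.-tuple T | ios s = v] by [].
have mUV := meas (fun g => U g && V g).
have mU : measurable (~` [set s : k.-tuple T | U [tuple of map grid_cell s]]).
  by apply: measurableC; exact: (meas U).
have fv : IOS k rho [set v] \is a fin_num by rewrite E1; exact: fin_num_measure.
rewrite /grid_ios -(sum_sort_cells _ _ (fun h => map fst h == v)).
apply/andP; split.
  rewrite -lee_fin fineK// -(mP (fun g => U g && V g)) E1.
  apply: le_measure; rewrite ?inE//.
  by move=> s /= /andP[Us]; rewrite iosU.
rewrite -lee_fin fineK// EFinD EFinB -(mP (fun g => U g && V g)) -(mP U) E1.
rewrite -probability_setC; last exact: (meas U).
apply: le_trans (measureU2 _ mUV mU).
apply: le_measure; rewrite ?inE//.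
  exact: measurableU.
move=> s /= sv; have [Us|Us] := boolP (U [tuple of map grid_cell s]).
  by left; apply/andP; split=> //; exact/iosU.
by right => /=; exact/negP.
Qed.

Definition ffact_ratio N k : R := (N ^_ k)%:R / N%:R ^+ k.

(** The positions of the cells are then i.i.d. uniform, and [ffact_ratio]
is the proportion of injective ones among all [k]-tuples of positions. *)
Lemma distinct_mass_uniform rho k :
  (forall i, rho (strip i) = (M.+1%:R^-1)%:E) ->
  distinct_mass rho k = ffact_ratio M.+1 k.
Proof.
move=> unif; apply: EFin_inj.
rewrite /distinct_mass -(@iid_map_pred _ _ _ rho _ _ measurable_grid_cell k
  (fun g => uniq (map (@cell_index A M.+1) g))).
pose q (p : T) := grid_index M p.2.
have mq i : measurable (q @^-1` [set i]) by exact: measurable_strip.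
have -> : [set s : k.-tuple T |
      uniq (map (@cell_index A M.+1) [tuple of map grid_cell s])] =
    [set s : k.-tuple T | uniq [tuple of map q s]].
  apply/funext => s /=; rewrite -map_comp.
  by rewrite -(map_inj_uniq val_inj) -map_comp.
rewrite (@iid_map_pred _ _ _ rho _ _ mq k (fun g => uniq g)).
rewrite (eq_bigr (fun=> M.+1%:R^-1 ^+ k)); last first.
  move=> g _; rewrite (eq_bigr (fun=> M.+1%:R^-1)); last first.
    by move=> i _; rewrite /cell_mass unif.
  by rewrite big_const_seq count_predT size_tuple iter_mulr_1.
rewrite sumr_const exprVn -[_ *+ #|_|]mulr_natl /ffact_ratio.
have := @card_uniq_tuples _ k (@predT 'I_M.+1); rewrite card_ord => <-.
congr (EFin (_%:R * _)); apply: eq_card => g; rewrite !inE.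
by rewrite all_predT.
Qed.

End sandwich.

(** * Empirical measures of words *)

Section word_measure.
Variables (R : realType) (A : finType) (a0 : A).
Local Notation T := (letter a0 * R)%type.

Lemma rho_word_pred (w : word A) (P : pred T) :
  rho_word R a0 w [set p | P p] =
  ((\sum_(j < size w) P (nth a0 w j : letter a0, j.+1%:R / (size w)%:R))%:R /
     (size w)%:R)%:E.
Proof.
rewrite /rho_word /= /empirical /mscale /= /msum.
rewrite (eq_bigr (fun j : 'I_(size w) =>
  (P (nth a0 w j : letter a0, j.+1%:R / (size w)%:R) : nat)%:R%:E)).
  by rewrite sumEFin -EFinM natr_sum mulrC.
move=> j _; apply: etrans; [exact: diracE|]; congr (_%:R%:E); congr nat_of_bool.
by apply/idP/idP; rewrite inE.
Qed.

(** With as many cells as letters, each letter of a word has its own cell. *)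
Lemma grid_index_nat M (j : 'I_M.+1) :
  grid_index M (j.+1%:R / M.+1%:R : R) = j.
Proof.
have gt i : (i < M)%N -> (i < grid_index M (j.+1%:R / M.+1%:R : R))%N = (i < j)%N.
  move=> iM; rewrite grid_index_gt// ltr_pM2r ?invr_gt0 ?ltr0n//.
  by rewrite ltr_nat ltnS.
apply: val_inj; apply/eqP; rewrite eqn_leq; apply/andP; split.
  rewrite leqNgt; apply/negP => ji.
  have jM := leq_trans ji (ltn_ord (grid_index M _) : _ <= M)%N.
  by rewrite gt// ltnn in ji.
rewrite leqNgt; apply/negP => ij.
have iM := leq_trans ij (ltn_ord j : _ <= M)%N.
by rewrite -gt// ltnn in ij.
Qed.

Lemma increasing_tupleP M k (h : k.-tuple (A * 'I_M)) :
  reflect (forall a b : 'I_k, (a < b)%N -> ((tnth h a).2 < (tnth h b).2)%N)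
    (increasing h).
Proof.
rewrite /increasing sorted_pairwise; last exact: ltn_trans.
case: k h => [|k] h.
  by rewrite tuple0 /=; apply: ReflectT => -[].
have nthE (i : 'I_k.+1) : nth 0%N (map (@cell_index A M) h) i = (tnth h i).2.
  by rewrite (nth_map (tnth h i)) ?size_tuple// -tnth_nth.
apply: (iffP (pairwiseP 0%N)) => H.
  move=> a b ab; rewrite -!nthE; apply: H => //; rewrite inE size_map size_tuple;
  exact: ltn_ord.
move=> i j; rewrite !inE size_map size_tuple => ik jk ij.
by have := H (Ordinal ik) (Ordinal jk) ij; rewrite -!nthE.
Qed.

(** An occurrence of [v] in [w] is recorded together with the letters it
reads, to match the index set of [grid_ios]. *)
Lemma subseq_countE (v : seq A) (w : seq A) :
  subseq_count v w = #|[pred h : (size v).-tuple (A * 'I_(size w)) |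
     [&& increasing h, map fst h == v &
         all (fun z : A * 'I_(size w) => nth a0 w z.2 == z.1) h]]|.
Proof.
pose f (j : {ffun 'I_(size v) -> 'I_(size w)}) :=
  [tuple (tnth (in_tuple v) i, j i) | i < size v].
rewrite /subseq_count (eq_card (B := [pred j : {ffun 'I_(size v) -> 'I_(size w)} |
   [forall a : 'I_(size v), forall b : 'I_(size v),
     (a < b)%N ==> (j a < j b)%N] &&
   [forall a, tnth (in_tuple w) (j a) == tnth (in_tuple v) a]])); last first.
  by move=> j; rewrite !inE; apply/idP/idP; rewrite in_setE.
rewrite -(@card_imset _ _ f); last first.
  move=> j1 j2 e; apply/ffunP => i.
  by have := congr1 (fun t => (tnth t i).2) e; rewrite !tnth_mktuple.
apply: eq_card => h; rewrite [RHS]inE; apply/imsetP/idP => [[j + ->]|].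
  rewrite inE => /andP[/forallP ij /forallP wj]; apply/and3P; split.
  - apply/increasing_tupleP => a b ab; rewrite !tnth_mktuple/=.
    by have /forallP/(_ b)/implyP := ij a; apply.
  - have e : [tuple of map fst (f j)] = in_tuple v.
      by apply: eq_from_tnth => i; rewrite tnth_map tnth_mktuple.
    by rewrite -[X in _ == X]/(val (in_tuple v)) -e.
  - apply/allP => z /tnthP[i ->]; rewrite tnth_mktuple /=.
    by have := wj i; rewrite (tnth_nth a0 (in_tuple w)).
move=> /and3P[/increasing_tupleP ih /eqP hv /allP wh].
have hvE : [tuple of map fst h] = in_tuple v by exact: val_inj.
exists [ffun i => (tnth h i).2].
  rewrite inE; apply/andP; split.
    apply/forallP => a; apply/forallP => b; apply/implyP.
    by rewrite !ffunE; exact: ih.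
  apply/forallP => a; rewrite ffunE (tnth_nth a0 (in_tuple w)) -hvE tnth_map.
  by apply: wh; exact: mem_tnth.
apply: eq_from_tnth => i; rewrite tnth_mktuple ffunE -hvE tnth_map.
by case: (tnth h i).
Qed.

Lemma grid_mass_word (w : word A) (z : A * 'I_(size w).-1.+1) :
  grid_mass (rho_word R a0 w) z = (nth a0 w z.2 == z.1)%:R / (size w)%:R.
Proof.
case: w z => -[//|x l] w0 [a i].
rewrite /grid_mass /cell_mass.
have -> : @grid_cell R A a0 (size l) @^-1` [set (a, i)] =
    [set p : T | grid_cell (size l) p == (a, i)].
  by apply/seteqP; split => p /eqP.
rewrite rho_word_pred [fine _]/=; congr (_%:R / _).
rewrite (bigD1 i)//= big1 ?addn0; last first.
  move=> j ji; rewrite /grid_cell /cell /= grid_index_nat xpair_eqE.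
  by rewrite (negbTE ji) andbF.
by rewrite /grid_cell /cell /= grid_index_nat xpair_eqE eqxx andbT.
Qed.

Lemma strip_word (w : word A) i :
  rho_word R a0 w (strip (M := (size w).-1) i) = ((size w).-1.+1%:R^-1)%:E.
Proof.
case: w i => -[//|x l] w0 i.
rewrite [size _]/= [in LHS](_ : strip i =
    [set p : T | grid_index (size l) p.2 == i]); last first.
  by apply/seteqP; split => p /eqP.
rewrite rho_word_pred -[RHS]mul1e -EFinM; congr (EFin (_ / _)).
rewrite (bigD1 i)//= big1 ?addn0; last first.
  by move=> j ji; rewrite /= grid_index_nat (negbTE ji).
by rewrite grid_index_nat eqxx.
Qed.

Lemma grid_ios_word (w : word A) (v : seq A) :
  (size v <= size w)%N ->
  grid_ios (size w).-1 (rho_word R a0 w) (in_tuple v) =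
  ffact_ratio R (size w) (size v) * ssd R v w.
Proof.
move=> vw.
rewrite /grid_ios /ssd /ffact_ratio.
under eq_bigr => h _ do under eq_bigr => z _ do rewrite grid_mass_word.
have -> : \sum_(h : (size v).-tuple (A * 'I_(size w).-1.+1) |
      increasing h && (map fst h == v))
    \prod_(z <- h) ((nth a0 w z.2 == z.1)%:R / (size w)%:R) =
  (subseq_count v w)%:R / (size w)%:R ^+ size v :> R.
  rewrite subseq_countE.
  case: w vw => -[//|x l] w0 vw /=.
  rewrite -sum1_card natr_sum big_distrl/= [RHS]big_mkcond [LHS]big_mkcond/=.
  apply: eq_bigr => h _; rewrite inE andbA.
  case: ifP => // _ /=.
  rewrite big_split/= big_const_seq count_predT size_tuple iter_mulr_1 -exprVn.
  have [/allP wh|/allPn[z zh wz]] := ifPn; last first.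
    by rewrite (big_rem z)//= (negbTE wz) !mul0r.
  by rewrite big_seq big1 ?mul1r// => z /wh ->.
rewrite -bin_ffact natrM.
have C0 : ('C(size w, size v))%:R != 0 :> R by rewrite pnatr_eq0 -lt0n bin_gt0.
have w0 : (size w)%:R != 0 :> R by rewrite pnatr_eq0 -lt0n word_gt0.
by field; rewrite C0 expf_neq0.
Qed.

Lemma grid_ios_word_tuple (w : word A) k (v : k.-tuple A) :
  (k <= size w)%N ->
  grid_ios (size w).-1 (rho_word R a0 w) v =
  ffact_ratio R (size w) k * ssd R v w.
Proof.
case: v => v vk; have vk' := eqP vk; subst k => vw.
by rewrite -grid_ios_word//; congr grid_ios; exact: val_inj.
Qed.

Lemma grid_ios_le_distinct M (rho : probability T R) k (v : k.-tuple A) :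
  grid_ios M rho v <= distinct_mass M rho k.
Proof.
rewrite /grid_ios -(sum_sort_cells _ _ (fun h => map fst h == v)) /distinct_mass.
rewrite big_mkcondr/=; apply: ler_sum => g _; case: ifP => // _.
by apply: prodr_ge0 => z _; rewrite /grid_mass /cell_mass fine_ge0.
Qed.

(** Both quantities differ from [grid_ios] by at most the probability of a
collision, in the finest subdivision that separates the letters. *)
Lemma ssd_IOS_word (w : word A) k (v : k.-tuple A) : (k <= size w)%N ->
  `|ssd R v w - fine (IOS k (rho_word R a0 w) [set v])| <=
  2 * (1 - ffact_ratio R (size w) k).
Proof.
move=> vw.
have rE : distinct_mass (size w).-1 (rho_word R a0 w) k =
    ffact_ratio R (size w) k.
  rewrite distinct_mass_uniform; last exact: strip_word.
  by rewrite prednK// word_gt0.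
have r0 : 0 < ffact_ratio R (size w) k.
  by rewrite divr_gt0// ?exprn_gt0// ltr0n ?ffact_gt0// word_gt0.
have := grid_ios_le_distinct (size w).-1 (rho_word R a0 w) v.
have /andP[] := IOS_sandwich (size w).-1 (rho_word R a0 w) v.
rewrite rE grid_ios_word_tuple//.
set r := ffact_ratio _ _ _ in r0 *; set s := ssd _ _ _; set I := fine _.
move=> sI Is sr; have s1 : s <= 1 by rewrite -(ler_pM2l r0) mulr1.
have r1 : 0 <= 1 - r by lra.
have s0 : 0 <= s by rewrite /s /ssd divr_ge0.
have := mulr_ge0 s0 r1; have : 0 <= (1 - s) * (1 - r).
  by apply: mulr_ge0 => //; lra.
move=> p1 p2; rewrite ler_norml; apply/andP; split; nra.
Qed.

End word_measure.

(** * Falling factorials *)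

Section falling_factorials.
Variable R : realType.

Lemma ffact_le_expn (N k : nat) : (N ^_ k <= N ^ k)%N.
Proof.
elim: k => [|k IH]; first by rewrite ffactn0.
by rewrite ffactnSr expnSr leq_mul// leq_subr.
Qed.

Lemma ffact_ratio_ge (N k : nat) : (0 < N)%N ->
  1 - k%:R ^+ 2 / N%:R <= ffact_ratio R N k.
Proof.
move=> N0; have N0' : 0 < N%:R :> R by rewrite ltr0n.
have r0 j : 0 <= ffact_ratio R N j by rewrite divr_ge0// exprn_ge0.
elim: k => [|k IH].
  by rewrite /ffact_ratio ffactn0 expr0 divr1 expr0n mul0r subr0.
have [kN|Nk] := leqP k N; last first.
  apply: le_trans (r0 _); rewrite subr_le0 ler_pdivlMr// mul1r.
  by rewrite -natrX ler_nat (leq_trans (ltnW Nk))// (leq_trans (leqnSn k))// leq_pmulr.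
have -> : ffact_ratio R N k.+1 = ffact_ratio R N k * (1 - k%:R / N%:R).
  rewrite /ffact_ratio ffactnSr natrM natrB// exprSr.
  by field; rewrite gt_eqF//= expf_neq0// gt_eqF.
have x1 : 0 <= 1 - k%:R / N%:R :> R.
  by rewrite subr_ge0 ler_pdivrMr// mul1r ler_nat.
have x0 : 0 <= k%:R / N%:R :> R by rewrite divr_ge0.
have r1 : ffact_ratio R N k <= 1.
  rewrite ler_pdivrMr ?exprn_gt0// mul1r -natrX ler_nat.
  exact: ffact_le_expn.
have i0 : 0 <= N%:R^-1 :> R by rewrite invr_ge0.
have k0 : 0 <= k%:R :> R by [].
rewrite -natr1.
have -> : (k%:R + 1) ^+ 2 / N%:R = k%:R ^+ 2 / N%:R + 2 * (k%:R / N%:R) + N%:R^-1 :> R.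
  by field; rewrite gt_eqF.
nra.
Qed.

Lemma ffact_ratio_cvg (N : nat -> nat) k : N n @[n --> \oo] --> \oo ->
  ffact_ratio R (N n) k @[n --> \oo] --> (1 : R).
Proof.
move=> /cvgnyPge Ny; apply/cvgrPdist_le => e e0.
near=> n.
have N0 : (0 < N n)%N by near: n; exact: Ny.
have := ffact_ratio_ge k N0.
have : k%:R ^+ 2 / (N n)%:R <= e.
  rewrite ler_pdivrMr ?ltr0n// mulrC -ler_pdivrMr//.
  have : (Num.truncn (k%:R ^+ 2 / e)).+1%:R <= (N n)%:R :> R.
    by rewrite ler_nat; near: n; exact: Ny.
  by apply: le_trans; rewrite ltW// truncnS_gt.
move=> ke kr; rewrite ger0_norm; last first.
  rewrite subr_ge0 ler_pdivrMr ?exprn_gt0 ?ltr0n// mul1r -natrX ler_nat.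
  exact: ffact_le_expn.
lra.
Unshelve. all: by end_near. Qed.
End falling_factorials.

(** * Letter distribution functions and the limit of the densities *)

Section letter_cdf.
Variables (R : realType) (A : finType) (a0 : A).
Local Notation L := (letter a0).
Local Notation T := (L * R)%type.
Implicit Types (rho : probability T R).

Definition letter_cdf rho (a : A) (t : R) : R :=
  fine (rho ([set a : L] `*` `]-oo, t]%classic)).

Lemma measurable_letterX (B : set L) (i : interval R) :
  measurable (B `*` [set` i] : set T).
Proof. by apply: measurableX => //; exact: measurable_itv. Qed.
Hint Resolve measurable_letterX : core.

Lemma letter_cdf_oc rho a s t : s <= t ->
  rho ([set a : L] `*` `]s, t]%classic) =
  (letter_cdf rho a t - letter_cdf rho a s)%:E.
Proof.
move=> st; rewrite EFinB /letter_cdf !fineK ?fin_num_measure//.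
have -> : [set a : L] `*` `]s, t]%classic =
    ([set a : L] `*` `]-oo, t]) `\` ([set a : L] `*` `]-oo, s]) :> set T.
  apply/seteqP; split => -[b x]/=; rewrite !in_itv/=.
    move=> [-> /andP[sx xt]]; split=> // -[_].
    by rewrite leNgt sx.
  move=> [[-> xt] H]; split=> //; rewrite xt andbT ltNge.
  by apply/negP => xs; apply: H.
rewrite measureD ?ltey_eq ?fin_num_measure//; congr (_ - rho _)%E.
apply/seteqP; split => -[b x]/=; rewrite !in_itv/=; first by move=> [_].
move=> [-> xs]; by split=> //; split => //; exact: le_trans st.
Qed.

(** The half-open interval makes the cells match increments of distribution
functions. *)
Definition supported rho : Prop := rho ([set: L] `*` `]0, 1]%classic) = 1%E.

Lemma supportedI rho B : supported rho -> measurable B ->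
  rho B = rho (B `&` ([set: L] `*` `]0, 1]%classic)).
Proof.
move=> rho1 mB; rewrite (measureDI rho mB (measurable_letterX setT `]0, 1])).
rewrite [X in (X + _)%E](_ : _ = 0%E) ?add0e//; apply/eqP.
rewrite eq_le measure_ge0 andbT.
have <- : rho (~` ([set: L] `*` `]0, 1]%classic)) = 0%E.
  by rewrite probability_setC// rho1 subee.
apply: le_measure; rewrite ?inE; first exact: measurableD.
  exact: measurableC.
by move=> p [].
Qed.

Lemma grid_index_itv M (i : 'I_M.+1) (x : R) : 0 < x <= 1 ->
  grid_index M x = i <-> i%:R / M.+1%:R < x <= i.+1%:R / M.+1%:R.
Proof.
move=> /andP[x0 x1].
have lo : (i <= grid_index M x)%N = (i%:R / M.+1%:R < x).
  case: i => -[|i] iM /=; first by rewrite mul0r x0 leq0n.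
  exact: grid_index_gt.
have hi : (grid_index M x <= i)%N = (x <= i.+1%:R / M.+1%:R).
  rewrite leqNgt; have [iM|Mi] := ltnP i M.
    by rewrite grid_index_gt// -leNgt.
  have iE : i = M :> nat by apply/eqP; rewrite eqn_leq Mi andbT -ltnS.
  rewrite iE divff// x1 -leqNgt -ltnS; exact: ltn_ord.
rewrite -lo -hi; split=> [->|/andP[h1 h2]]; first by rewrite !leqnn.
by apply: val_inj; apply/eqP; rewrite eqn_leq h1 h2.
Qed.

Lemma grid_points_le M (i : nat) : (i <= M)%N ->
  [/\ 0 <= i%:R / M.+1%:R :> R, i%:R / M.+1%:R <= i.+1%:R / M.+1%:R :> R &
      i.+1%:R / M.+1%:R <= 1 :> R].
Proof.
move=> iM; split; first by rewrite divr_ge0.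
  by rewrite ler_pM2r ?invr_gt0 ?ltr0n// ler_nat.
by rewrite ler_pdivrMr ?ltr0n// mul1r ler_nat ltnS.
Qed.

(** The unbounded extremities of the first and of the last cell carry no mass. *)
Lemma supported_strip rho (B : set L) M (i : 'I_M.+1) : supported rho ->
  rho (B `*` (@grid_index R M @^-1` [set i])) =
  rho (B `*` `]i%:R / M.+1%:R, i.+1%:R / M.+1%:R]%classic).
Proof.
move=> rho1; rewrite supportedI//; last first.
  by apply: measurableX => //; exact: measurable_grid_index.
have [i0 ii i1] := @grid_points_le M i (ltn_ord i).
congr (rho _); apply/seteqP; split => -[b x]/=.
  move=> [[Bb xi] [_]]; rewrite in_itv/= => /grid_index_itv H.
  by split=> //; apply/H.
move=> [Bb]; rewrite in_itv/= => xi.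
have x01 : 0 < x <= 1.
  by case/andP: xi => h1 h2; rewrite (le_lt_trans i0 h1) (le_trans h2 i1).
by split; split=> //; exact/grid_index_itv.
Qed.

Lemma grid_massE rho M (z : A * 'I_M.+1) : supported rho ->
  grid_mass rho z = letter_cdf rho z.1 (z.2.+1%:R / M.+1%:R) -
                    letter_cdf rho z.1 (z.2%:R / M.+1%:R).
Proof.
move=> rho1; rewrite /grid_mass /cell_mass grid_cellE supported_strip//.
rewrite letter_cdf_oc//.
by have [] := @grid_points_le M z.2 (ltn_ord z.2).
Qed.

Lemma calC_oc rho s t : calC rho -> 0 <= s -> s <= t -> t <= 1 ->
  rho ([set: L] `*` `]s, t]%classic) = (t - s)%:E.
Proof.
move=> rhoC s0 st t1; rewrite EFinB.
rewrite -(rhoC t) ?(le_trans s0 st)// -(rhoC s) ?s0 ?(le_trans st t1)//.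
have -> : [set: L] `*` `]s, t]%classic =
    ([set: L] `*` `[0, t]) `\` ([set: L] `*` `[0, s]) :> set T.
  apply/seteqP; split => -[b x]/=; rewrite !in_itv/=.
    move=> [_ /andP[sx xt]]; split; last by move=> [_ /andP[_]]; rewrite leNgt sx.
    by rewrite xt (le_trans s0 (ltW sx)).
  move=> [[_ /andP[x0 xt]] H]; split=> //; rewrite xt andbT ltNge.
  by apply/negP => xs; apply: H; rewrite x0.
rewrite measureD ?ltey_eq ?fin_num_measure//; congr (_ - rho _)%E.
apply/seteqP; split => -[b x]/=; rewrite !in_itv/=; first by move=> [_].
move=> [_ /andP[x0 xs]]; by split=> //; split => //; rewrite x0 ?xs ?(le_trans xs st).
Qed.

Lemma calC_supported rho : calC rho -> supported rho.
Proof. by move=> rhoC; rewrite /supported calC_oc// subr0. Qed.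

Lemma calC_strip rho M (i : 'I_M.+1) : calC rho ->
  rho (strip i) = (M.+1%:R^-1)%:E.
Proof.
move=> rhoC; have -> : strip i = setT `*` (@grid_index R M @^-1` [set i]) :> set T.
  by apply/seteqP; split => -[b x] //= [].
have [i0 ii i1] := @grid_points_le M i (ltn_ord i).
rewrite supported_strip; last exact: calC_supported.
by rewrite calC_oc// -mulrBl -natr1 addrC addKr mul1r.
Qed.

Lemma supported_word w : supported (rho_word R a0 w).
Proof.
rewrite /supported (_ : _ `*` _ = [set p : T | 0 < p.2 <= 1]); last first.
  apply/seteqP; split => -[b x] /=; rewrite in_itv//=.
  by case.
rewrite rho_word_pred (eq_bigr (fun=> 1%N)).
  rewrite sum1_card card_ord divff// pnatr_eq0 -lt0n; exact: word_gt0.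
move=> j _ /=; rewrite divr_gt0 ?ltr0n//=; last exact: word_gt0.
by rewrite ler_pdivrMr ?ltr0n ?word_gt0// mul1r ler_nat ltn_ord.
Qed.

End letter_cdf.

Section limit.
Variables (R : realType) (A : finType) (a0 : A) (w : nat -> word A).
Hypothesis w_infty : size (w n) @[n --> \oo] --> \oo.
Variable rho : probability (letter a0 * R)%type R.
Hypothesis rhoC : calC rho.

(** Convergence is asked on the unit interval only, where the limit lives. *)
Definition cdf_cvg := forall (a : A) (t : R), 0 <= t <= 1 ->
  letter_cdf (rho_word R a0 (w n)) a t @[n --> \oo] --> letter_cdf rho a t.

Hypothesis cvgF : cdf_cvg.

Lemma grid_mass_cvg M (z : A * 'I_M.+1) :
  grid_mass (rho_word R a0 (w n)) z @[n --> \oo] --> grid_mass rho z.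
Proof.
have [i0 ii i1] := @grid_points_le R M z.2 (ltn_ord z.2).
rewrite grid_massE; last exact: calC_supported.
rewrite (_ : (fun n => _) = (fun n =>
    letter_cdf (rho_word R a0 (w n)) z.1 (z.2.+1%:R / M.+1%:R) -
    letter_cdf (rho_word R a0 (w n)) z.1 (z.2%:R / M.+1%:R))); last first.
  by apply/funext => n; rewrite grid_massE//; exact: supported_word.
by apply: cvgB; apply: cvgF; rewrite ?i0 ?i1 ?(le_trans ii) ?(le_trans i0).
Qed.

Lemma cvg_sum_prod (Q : finType) k (P : pred (k.-tuple Q)) (m : nat -> Q -> R)
    (m' : Q -> R) : (forall z, m n z @[n --> \oo] --> m' z) ->
  \sum_(g : k.-tuple Q | P g) \prod_(z <- g) m n z @[n --> \oo] -->
  \sum_(g : k.-tuple Q | P g) \prod_(z <- g) m' z.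
Proof.
move=> mm'; apply: cvg_big => [|g _]; first exact: add_continuous.
by apply: cvg_big => [|z _]; [exact: mul_continuous|exact: mm'].
Qed.

(** For a fixed number of cells the finite expression converges, and the error
of the approximation is uniformly small for long words. *)
Lemma ssd_cvg k (v : k.-tuple A) :
  ssd R v (w n) @[n --> \oo] --> fine (IOS k rho [set v]).
Proof.
apply: approx_cvg => e e0.
have [M rM] : exists M, 1 - ffact_ratio R M.+1 k <= e / 4.
  have e4 : 0 < e / 4 by rewrite divr_gt0.
  have Soo : n.+1 @[n --> \oo] --> \oo.
    by apply/cvgnyPge => B; exists B => // m; exact: leqW.
  have /cvgrPdist_le/(_ _ e4)[M _ HM] := @ffact_ratio_cvg R _ k Soo.
  exists M; apply: le_trans (HM M (leqnn M)); exact: ler_norm.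
pose S n := grid_ios M (rho_word R a0 (w n)) v.
pose D n := distinct_mass M (rho_word R a0 (w n)) k.
have DE : distinct_mass M rho k = ffact_ratio R M.+1 k.
  by apply: distinct_mass_uniform => i; exact: calC_strip.
have Scvg : S n @[n --> \oo] --> grid_ios M rho v.
  by apply: cvgMl_tmp; apply: cvg_sum_prod => z; exact: grid_mass_cvg.
have Dcvg : D n @[n --> \oo] --> ffact_ratio R M.+1 k.
  by rewrite -DE; apply: cvg_sum_prod => z; exact: grid_mass_cvg.
have e4 : 0 < e / 4 by rewrite divr_gt0.
exists S, (grid_ios M rho v); split => //.
  have /andP[] := IOS_sandwich M rho v; rewrite DE => h1 h2.
  by rewrite ler_norml; apply/andP; split; lra.
have /cvgrPdist_le/(_ _ e4) Dn := Dcvg.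
have /cvgrPdist_le/(_ _ e4) rn := @ffact_ratio_cvg R _ k w_infty.
near=> n.
have kw : (k <= size (w n))%N.
  by near: n; have /cvgnyPge := w_infty; apply.
have := ssd_IOS_word R a0 v kw.
have /andP[] := IOS_sandwich M (rho_word R a0 (w n)) v.
rewrite -/(S n) -/(D n).
have : `|ffact_ratio R M.+1 k - D n| <= e / 4 by near: n.
have : `|1 - ffact_ratio R (size (w n)) k| <= e / 4 by near: n.
rewrite !ler_norml => /andP[? ?] /andP[? ?] ? ? /andP[? ?].
by apply/andP; split; lra.
Unshelve. all: by end_near. Qed.

End limit.

(** * Weak convergence against convergence of distribution functions *)

Section functions_on_letters.
Variables (R : realType) (A : finType) (a0 : A).
Local Notation L := (letter a0).
Local Notation T := (L * R)%type.

(** Finitely many letters: a function on the product is glued from its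
sections, both for measurability and, below, for continuity. *)
Lemma measurable_fun_letter (f : T -> R) :
  (forall a, measurable_fun setT (fun x => f (a, x))) -> measurable_fun setT f.
Proof.
move=> mf _ B mB; rewrite setTI.
have -> : f @^-1` B =
    \bigcup_(a in [set: A]) ([set a : L] `*` ((fun x => f (a, x)) @^-1` B)).
  apply/seteqP; split => [[a x] Bax|[b x] [a _ [/= -> ?]]//].
  by exists a.
apply: fin_bigcup_measurable => // a _; apply: measurableX => //.
by rewrite -[X in measurable X]setTI; exact: mf.
Qed.

Lemma continuous_letterP (f : T -> R) :
  continuous f <-> forall a, continuous (fun x => f (a, x)).
Proof.
split=> [cf a x|cf [a x]].
  apply: (@continuous_comp _ _ _ (fun x => (a : L, x) : T) f); last exact: cf.
  move=> B [[U V]/= [nU nV] UV]; apply: filterS nV => y Vy; apply: UV.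
  by split=> //; exact: nbhs_singleton nU.
move=> B fB; have := cf a x B fB => nB.
exists ([set a : L], (fun x => f (a, x)) @^-1` B) => /=.
  by split=> //; exact: (proj2 (principal_filterP _ _)).
by move=> [b y] [/= -> ?].
Qed.

(** Equal to [1] up to [s], to [0] from [t] on, and affine in between. *)
Definition trapezoid (s t x : R) : R :=
  Num.max 0 (Num.min 1 ((t - x) / (t - s))).

Lemma trapezoid_continuous s t : continuous (trapezoid s t).
Proof.
move=> x.
apply: (@continuous_max R R (cst 0) (fun x => Num.min 1 ((t - x) / (t - s)))).
  exact: cvg_cst.
apply: (@continuous_min R R (cst 1) (fun x => (t - x) / (t - s))).
  exact: cvg_cst.
by apply: cvgMr_tmp; apply: cvgB; [exact: cvg_cst|exact: cvg_id].
Qed.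

Lemma trapezoid_itv s t x : 0 <= trapezoid s t x <= 1.
Proof. by rewrite /trapezoid le_max lexx /= ge_max ler01 ge_min lexx. Qed.

Lemma trapezoid_left s t x : s < t -> x <= s -> trapezoid s t x = 1.
Proof.
move=> st xs; have ts0 : 0 < t - s by rewrite subr_gt0.
rewrite /trapezoid min_l ?max_r// ler_pdivlMr// mul1r; lra.
Qed.

Lemma trapezoid_right s t x : s < t -> t <= x -> trapezoid s t x = 0.
Proof.
move=> st xs; have ts0 : 0 < t - s by rewrite subr_gt0.
by rewrite /trapezoid max_l// ge_min ler_pdivrMr// mul0r subr_le0 xs orbT.
Qed.

Definition letter_trapezoid (a : A) (s t : R) (p : T) : R :=
  (p.1 == a)%:R * trapezoid s t p.2.

Lemma letter_trapezoid_continuous a s t : continuous (letter_trapezoid a s t).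
Proof.
apply/continuous_letterP => b x; rewrite /letter_trapezoid/=.
by apply: cvgMl_tmp; exact: trapezoid_continuous.
Qed.

Lemma letter_trapezoid_itv a s t p : 0 <= letter_trapezoid a s t p <= 1.
Proof.
have /andP[h0 h1] := trapezoid_itv s t p.2.
rewrite /letter_trapezoid; case: eqP => _; rewrite ?mul1r ?h0//.
by rewrite mul0r lexx ler01.
Qed.

Lemma measurable_letter_trapezoid a s t :
  measurable_fun setT (letter_trapezoid a s t).
Proof.
apply: measurable_fun_letter => b; apply: continuous_measurable_fun.
by move: b; apply/continuous_letterP; exact: letter_trapezoid_continuous.
Qed.

Lemma integral_trapezoid_bounds (mu : probability T R) a s t : s < t ->
  ((letter_cdf mu a s)%:E <= \int[mu]_x (letter_trapezoid a s t x)%:E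
    <= (letter_cdf mu a t)%:E)%E.
Proof.
move=> st; have mI u : measurable ([set a : L] `*` `]-oo, u]%classic : set T).
  exact: measurable_letterX.
have mh := measurable_letter_trapezoid a s t.
have h0 p : 0 <= letter_trapezoid a s t p by case/andP: (letter_trapezoid_itv a s t p).
rewrite /letter_cdf !fineK ?fin_num_measure//.
rewrite -[X in (mu X <= _ <= _)%E]setIT -[X in (_ <= _ <= mu X)%E]setIT.
rewrite -!integral_indic//; apply/andP; split.
  apply: ge0_le_integral => //.
  - by apply/measurable_EFinP; exact: measurable_indic.
  - exact/measurable_EFinP.
  move=> [b x] _; rewrite lee_fin indicE.
  case: (boolP (_ \in _)) => [|_]; last exact: h0.
  rewrite inE /letter_trapezoid/= in_itv/= => -[-> xs].
  by rewrite trapezoid_left// eqxx mul1r.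
apply: ge0_le_integral => //.
- by move=> p _; rewrite lee_fin.
- exact/measurable_EFinP.
- by apply/measurable_EFinP; exact: measurable_indic.
move=> [b x] _; rewrite lee_fin indicE.
case: (boolP (_ \in _)) => [_|].
  by case/andP: (letter_trapezoid_itv a s t (b, x)).
rewrite notin_setE /letter_trapezoid/= in_itv/=; case: eqP => [-> H|_ _].
  by rewrite mul1r trapezoid_right// ltW// ltNge; apply/negP => xt; exact: H.
by rewrite mul0r.
Qed.

End functions_on_letters.

Section weak_cdf.
Variables (R : realType) (A : finType) (a0 : A) (w : nat -> word A).
Variable rho : probability (letter a0 * R)%type R.
Hypothesis rhoC : calC rho.
Local Notation L := (letter a0).

Lemma letter_cdf_homo (mu : probability (L * R)%type R) a s t : s <= t ->
  letter_cdf mu a s <= letter_cdf mu a t.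
Proof.
by move=> st; rewrite -subr_ge0 -lee_fin -letter_cdf_oc.
Qed.

(** Each letter carries at most the total mass, which is Lebesgue measure on
the unit interval. *)
Lemma letter_cdf_lip a s t : s <= t ->
  letter_cdf rho a t - letter_cdf rho a s <= t - s.
Proof.
move=> st; rewrite -lee_fin -letter_cdf_oc//.
have mT u v : measurable ([set: L] `*` `]u, v]%classic : set (L * R)).
  exact: measurable_letterX.
apply: le_trans (_ : (rho ([set: L] `*` `]s, t]%classic) <= _)%E).
  by apply: le_measure; rewrite ?inE//; [exact: measurable_letterX|move=> p []].
rewrite supportedI//; last exact: calC_supported.
pose s' := Num.max s 0; pose t' := Num.min t 1.
apply: le_trans (_ : (rho ([set: L] `*` `]s', t']%classic) <= _)%E).
  apply: le_measure; rewrite ?inE//; first exact: measurableI.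
  move=> [b x] /= [[_ +] [_]]; rewrite !in_itv/= => /andP[h1 h2] /andP[h3 h4].
  by split=> //; rewrite gt_max le_min h1 h2 h3 h4.
have [s't'|t's'] := leP s' t'; last first.
  rewrite (_ : _ `*` _ = set0) ?measure0 ?lee_fin ?subr_ge0//.
  apply/seteqP; split => -[b x]//= [_]; rewrite in_itv/= => /andP[h1 h2].
  by have := lt_le_trans h1 h2; rewrite ltNge ltW.
have [h1 h2] : 0 <= s' /\ t' <= 1 by rewrite le_max ge_min !lexx !orbT.
rewrite calC_oc// lee_fin lerB//; first by rewrite ge_min lexx.
by rewrite le_max lexx.
Qed.

(** The indicator of a half-line lies between two trapezoids whose slopes sit on
either side of [t]; the Lipschitz bound controls the gap. *)
Lemma weak_cdf_cvg : weak_cvg (fun n => rho_word R a0 (w n)) rho ->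
  cdf_cvg w rho.
Proof.
move=> H a t _; apply/cvgrPdist_le => e e0.
have cvgI s u : s < u -> exists2 l : R, letter_cdf rho a s <= l <= letter_cdf rho a u &
   \forall n \near \oo, letter_cdf (rho_word R a0 (w n)) a s <= l + e / 2 /\
      l - e / 2 <= letter_cdf (rho_word R a0 (w n)) a u.
  move=> su; pose f := letter_trapezoid (a0 := a0) a s u.
  have fin (mu : probability (L * R)%type R) : (\int[mu]_x (f x)%:E)%E \is a fin_num.
    have /andP[h1 h2] := integral_trapezoid_bounds mu a su.
    by rewrite fin_numElt (lt_le_trans _ h1) ?ltNyr// (le_lt_trans h2) ?ltry.
  exists (fine (\int[rho]_x (f x)%:E)%E).
    have := integral_trapezoid_bounds rho a su.
    by rewrite -/f -[X in (_ <= X <= _)%E]fineK// !lee_fin.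
  have bf : bounded_fun f.
    exists 1; split => // M M1 p _ /=; apply: le_trans (ltW M1).
    by have /andP[h0 h1] := letter_trapezoid_itv a s u p; rewrite ger0_norm.
  have := H f (@letter_trapezoid_continuous _ _ _ a s u) bf.
  rewrite -[X in _ --> X]fineK// => /fine_cvg/cvgrPdist_le/(_ (e / 2)).
  rewrite divr_gt0// => /(_ isT); apply: filterS => n.
  have := integral_trapezoid_bounds (rho_word R a0 (w n)) a su.
  rewrite -/f -[X in (_ <= X <= _)%E]fineK// !lee_fin/= => /andP[h1 h2].
  by rewrite ler_norml => /andP[h3 h4]; split; lra.
have e2 : 0 < e / 2 by rewrite divr_gt0.
have [|l1 /andP[l1a l1b] n1] := cvgI t (t + e / 2); first by rewrite ltrDl.
have [|l2 /andP[l2a l2b] n2] := cvgI (t - e / 2) t; first by rewrite gtrBl.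
have d1 : letter_cdf rho a (t + e / 2) - letter_cdf rho a t <= e / 2.
  by apply: le_trans (letter_cdf_lip _ _) _; lra.
have d2 : letter_cdf rho a t - letter_cdf rho a (t - e / 2) <= e / 2.
  by apply: le_trans (letter_cdf_lip _ _) _; lra.
near=> n.
have [? _] : letter_cdf (rho_word R a0 (w n)) a t <= l1 + e / 2 /\
      l1 - e / 2 <= letter_cdf (rho_word R a0 (w n)) a (t + e / 2) by near: n.
have [_ ?] : letter_cdf (rho_word R a0 (w n)) a (t - e / 2) <= l2 + e / 2 /\
      l2 - e / 2 <= letter_cdf (rho_word R a0 (w n)) a t by near: n.
by rewrite ler_norml; apply/andP; split; lra.
Unshelve. all: by end_near. Qed.
End weak_cdf.

Section heine.
Variable R : realType.

(** Only one of the two points has to lie in the segment, which is what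
covering compactness gives directly. *)
Lemma heine_segment (f : R -> R) (a b e : R) : continuous f -> 0 < e ->
  exists2 d, 0 < d & forall x y, x \in `[a, b] -> `|x - y| < d ->
    `|f x - f y| <= e.
Proof.
move=> cf e0.
have : \forall d \near 0^'+, `[a, b] `<=`
    (fun x => forall y, `|x - y| < d -> `|f x - f y| <= e).
  apply: (proj1 (compact_near_coveringP _) (@segment_compact R a b)) => x _.
  have e2 : 0 < e / 2 by rewrite divr_gt0.
  have /cvgrPdist_le/(_ _ e2) := cf x.
  move=> /nbhs_ballP[r /= r0 xr].
  have r2 : 0 < r / 2 by rewrite divr_gt0.
  near=> x' d => y x'y.
  have x'r : `|x - x'| < r / 2.
    by near: x'; apply: cvgr_dist_lt => //; exact: cvg_id.
  have dr : d < r / 2 by near: d; exact: nbhs_right_lt.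
  have h1 : `|f x - f x'| <= e / 2 by apply: xr; rewrite /ball/=; lra.
  have h2 : `|f x - f y| <= e / 2.
    apply: xr; rewrite /ball/= (_ : x - y = (x - x') + (x' - y)); last by ring.
    by rewrite (splitr r) (le_lt_trans (ler_normD _ _))// ltrD// (lt_trans x'y).
  rewrite (_ : f x' - f y = (f x - f y) - (f x - f x')); last by ring.
  by apply: le_trans (ler_normB _ _) _; lra.
move=> H; near (0 : R)^'+ => d; exists d; first by near: d; exact: nbhs_right_gt.
move=> x y xab; have : `[a, b] `<=`
   (fun x => forall y, `|x - y| < d -> `|f x - f y| <= e) by near: d.
by move=> /(_ x xab y).
Unshelve. all: by end_near. Qed.

End heine.

Section cdf_weak.
Variables (R : realType) (A : finType) (a0 : A).
Local Notation L := (letter a0).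
Local Notation T := (L * R)%type.

(** Integral of the function that takes, on each cell, the value of [f] at the
right end of the cell. *)
Definition grid_sum M (f : T -> R) (mu : probability T R) : R :=
  \sum_(z : A * 'I_M.+1) f (z.1 : L, z.2.+1%:R / M.+1%:R) * grid_mass mu z.

Lemma integral_bounded_fin (f : T -> R) (mu : probability T R) :
  measurable_fun setT f -> bounded_fun f -> mu.-integrable setT (EFin \o f).
Proof.
move=> mf bf; apply: measurable_bounded_integrable => //.
by rewrite ltey_eq fin_num_measure.
Qed.

Lemma integral_grid_sum M (f : T -> R) (mu : probability T R) (e : R) :
    0 <= e -> continuous f -> bounded_fun f -> supported mu ->
    (forall a x y, x \in `[0, 1] -> y \in `[0, 1] -> `|x - y| <= M.+1%:R^-1 ->
      `|f (a, x) - f (a, y)| <= e) ->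
  `|fine (\int[mu]_x (f x)%:E)%E - grid_sum M f mu| <= e.
Proof.
move=> e0 cf bf mu1 fe.
have mf : measurable_fun setT f.
  apply: measurable_fun_letter => a; apply: continuous_measurable_fun.
  by move: a; exact/continuous_letterP.
have intf := integral_bounded_fin mu mf bf.
pose c (z : A * 'I_M.+1) := f (z.1 : L, z.2.+1%:R / M.+1%:R).
pose h (p : T) := \sum_z c z * \1_(@grid_cell R A a0 M @^-1` [set z]) p.
have hE p : h p = c (grid_cell M p).
  rewrite /h (bigD1 (grid_cell M p))//= big1 ?addr0.
    by rewrite indicE mem_set// mulr1.
  move=> z zp; rewrite indicE memNset ?mulr0// => /= pz.
  by rewrite pz eqxx in zp.
have intc z : mu.-integrable setT
    (fun p => (c z)%:E * (\1_(@grid_cell R A a0 M @^-1` [set z]) p)%:E)%E.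
  by apply: integrableZl => //; apply: integrable_indic => //;
    exact: measurable_grid_cell.
have hS : EFin \o h = (fun p => \sum_z ((c z)%:E *
    (\1_(@grid_cell R A a0 M @^-1` [set z]) p)%:E))%E.
  by apply/funext => p; rewrite /= /h -sumEFin.
have inth : mu.-integrable setT (EFin \o h).
  by rewrite hS; apply: integrable_sum.
have -> : grid_sum M f mu = fine (\int[mu]_x (h x)%:E)%E.
  rewrite -[X in integral _ _ X]/(EFin \o h) hS integral_sum//.
  rewrite (eq_bigr (fun z => (c z * grid_mass mu z)%:E)) ?sumEFin// => z _.
  rewrite integralZl ?integral_indic ?setIT ?EFinM -?cell_massE//.
  - exact: measurable_grid_cell.
  - exact: measurable_grid_cell.
  - by apply: integrable_indic => //; exact: measurable_grid_cell.
rewrite -[fine (integral _ _ (fun x => (f x)%:E))]/(Rintegral mu setT f).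
rewrite -[fine (integral _ _ (fun x => (h x)%:E))]/(Rintegral mu setT h).
rewrite -RintegralB// /Rintegral.
have intfh : mu.-integrable setT (EFin \o (f \- h)).
  rewrite (_ : EFin \o _ = (EFin \o f) \- (EFin \o h))%E; last exact/funext.
  exact: integrableB.
have mfh : measurable_fun setT (EFin \o (f \- h)).
  by case/integrableP : intfh.
have fin : (\int[mu]_x (f x - h x)%:E)%E \is a fin_num.
  exact: integrable_fin_num intfh.
rewrite -lee_fin -[X in (X <= _)%E]/(abse (fine _)%:E) fineK//.
apply: le_trans (le_abse_integral mu measurableT mfh) _.
rewrite -[X in (_ <= X)%E]mule1 -(@probability_setT _ _ _ mu).
apply: integral_le_bound => //.
exists (~` ([set: L] `*` `]0, 1]%classic)); split.
- by apply: measurableC; exact: measurable_letterX.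
- have mS := @measurable_letterX R A a0 setT `]0, 1].
  by apply: etrans (probability_setC mu mS) _; rewrite mu1 subee.
move=> [a x] /= H xS; apply: H => _; rewrite lee_fin hE /c /grid_cell/cell/=.
move: xS => [_]; rewrite in_itv/= => x01.
have x01' : x \in `[0, 1] by rewrite in_itv/=; case/andP: x01 => /ltW -> ->.
set i := grid_index M x.
have /andP[h1 h2] : i%:R / M.+1%:R < x <= i.+1%:R / M.+1%:R.
  exact/grid_index_itv.
have step : i.+1%:R / M.+1%:R = i%:R / M.+1%:R + M.+1%:R^-1 :> R.
  by rewrite -natr1 mulrDl mul1r.
have N0 : 0 <= M.+1%:R^-1 :> R by rewrite invr_ge0.
apply: fe => //.
  rewrite in_itv/= divr_ge0//= ler_pdivrMr ?ltr0n// mul1r ler_nat.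
  exact: ltn_ord.
have key (y u v N : R) : u < y -> y <= v -> v = u + N -> 0 <= N -> `|y - v| <= N.
  by move=> uy yv vE N0'; rewrite ler_norml; apply/andP; split; lra.
exact: key h1 h2 step N0.
Qed.

(** A continuous function is uniformly approximated by its values on a fine
grid, and for a fixed grid the integral is a finite sum of cell masses. *)
Lemma cdf_weak_cvg (w : nat -> word A) (rho : probability T R) : calC rho ->
  cdf_cvg w rho -> weak_cvg (fun n => rho_word R a0 (w n)) rho.
Proof.
move=> rhoC Fcvg f cf bf.
have mf : measurable_fun setT f.
  apply: measurable_fun_letter => a; apply: continuous_measurable_fun.
  by move: a; exact/continuous_letterP.
have fin (mu : probability T R) : (\int[mu]_x (f x)%:E)%E \is a fin_num.
  exact: integrable_fin_num (integral_bounded_fin mu mf bf).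
rewrite -[X in _ --> X]fineK//.
rewrite (_ : (fun n => _) = EFin \o
    (fun n => fine (\int[rho_word R a0 (w n)]_x (f x)%:E)%E)); last first.
  by apply/funext => n /=; rewrite fineK.
apply: cvg_EFin; first by near=> n.
apply: approx_cvg => e e0.
have [d d0 fd] : exists2 d, 0 < d & forall (a : L) x y, x \in `[0, 1] ->
    `|x - y| < d -> `|f (a, x) - f (a, y)| <= e.
  have cfa := proj1 (continuous_letterP f) cf.
  have dP (a : A) := heine_segment 0 1 (cfa a) e0.
  have /boolp.choice[ds dsP] : forall a : A, exists d, 0 < d /\
      forall x y, x \in `[0, 1] -> `|x - y| < d ->
        `|f (a : L, x) - f (a : L, y)| <= e.
    by move=> a; have [d ? ?] := dP a; exists d.
  exists (\big[Num.min/1]_a ds a).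
    by apply: lt_bigmin => // a _; have [] := dsP a.
  move=> a x y x01 xy; apply: (dsP a).2 => //.
  by apply: lt_le_trans xy _; exact: bigmin_le_cond.
pose M := Num.truncn d^-1.
have Md : M.+1%:R^-1 < d.
  by rewrite invf_plt ?posrE// truncnS_gt.
have fe (a : L) x y : x \in `[0, 1] -> y \in `[0, 1] -> `|x - y| <= M.+1%:R^-1 ->
    `|f (a, x) - f (a, y)| <= e.
  by move=> x01 _ xy; apply: fd => //; exact: le_lt_trans Md.
exists (fun n => grid_sum M f (rho_word R a0 (w n))), (grid_sum M f rho); split.
- apply: cvg_big => [|z _]; first exact: add_continuous.
  by apply: cvgMl_tmp; exact: grid_mass_cvg.
- rewrite distrC; apply: integral_grid_sum => //; first exact: ltW.
  exact: calC_supported.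
- apply: nearW => n /=; apply: integral_grid_sum => //; first exact: ltW.
  exact: supported_word.
Unshelve. all: by end_near. Qed.
End cdf_weak.

(** * Words with a prescribed first letter *)

Lemma big_tuple_cons (V : nmodType) (Q : finType) k
    (P : pred (seq Q)) (F : seq Q -> V) :
  \sum_(h : k.+1.-tuple Q | P h) F h =
  \sum_(z : Q) \sum_(h : k.-tuple Q | P (z :: h)) F (z :: h).
Proof.
rewrite pair_big_dep /=.
rewrite (reindex (fun p : Q * k.-tuple Q => [tuple of p.1 :: p.2])) //=.
exists (fun h : k.+1.-tuple Q => (thead h, [tuple of behead h])) => [[z h] _|h _] /=.
  by congr pair; apply: val_inj.
by rewrite [RHS]tuple_eta; apply: val_inj.
Qed.

Lemma sum_tuple_prod (R : comNzRingType) (Q : finType) k (m : Q -> R) :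
  \sum_(h : k.-tuple Q) \prod_(z <- h) m z = (\sum_z m z) ^+ k.
Proof.
elim: k => [|k IH].
  rewrite (eq_bigr (fun=> 1)) => [|h _]; last by rewrite tuple0 big_nil.
  by rewrite sumr_const card_tuple expn0.
rewrite (big_tuple_cons _ xpredT (fun h => \prod_(z <- h) m z)) exprS -IH.
rewrite big_distrl; apply: eq_bigr => z _ /=; rewrite big_distrr.
by apply: eq_bigr => h _; rewrite big_cons.
Qed.

Section first_letter.
Variables (R : realType) (A : finType) (a0 : A) (M : nat).
Local Notation T := (letter a0 * R)%type.
Local Notation Q := (A * 'I_M.+1)%type.
Variable rho : probability T R.
Implicit Types (z : Q).

Definition mass_after z : R :=
  \sum_(z' : Q | (z.2 < z'.2)%N) grid_mass rho z'.

Lemma grid_mass_ge0 z : 0 <= grid_mass rho z.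
Proof. by rewrite fine_ge0. Qed.

(** In an increasing sequence of cells starting at [z], the other cells lie
after [z]; reordering them freely trades one factorial for distinctness. *)
Lemma sum_grid_ios_first k (a : A) :
  \sum_(u : k.-tuple A) grid_ios M rho [tuple of a :: u] =
  k.+1%:R * \sum_(z : Q | z.1 == a) grid_mass rho z *
    \sum_(g : k.-tuple Q | uniq (map (@cell_index A M.+1) g) &&
       all (fun z' : Q => z.2 < z'.2)%N g) \prod_(z' <- g) grid_mass rho z'.
Proof.
rewrite -big_distrr/= factS natrM -mulrA; congr (_ * _).
pose P (h : seq Q) := increasing h && (ohead (map fst h) == Some a).
transitivity (k`!%:R * \sum_(h : k.+1.-tuple Q | P h)
    \prod_(z <- h) grid_mass rho z).
  congr (_ * _); rewrite [RHS](partition_big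
    (fun h : k.+1.-tuple Q => [tuple of behead (map fst h)]) xpredT)//=.
  apply: eq_bigr => u _; apply: eq_bigl; case/tupleP => z h.
  rewrite /P /= -andbA eqseq_cons (inj_eq Some_inj).
  by case: increasing; case: (z.1 == a).
rewrite (big_tuple_cons _ P (fun h => \prod_(z <- h) grid_mass rho z)).
rewrite [RHS]big_mkcond big_distrr; apply: eq_bigr => z _ /=.
rewrite (eq_bigl (fun h : k.-tuple Q => (z.1 == a) &&
    (increasing h && all (fun z' : Q => (z.2 < z'.2)%N) h))); last first.
  move=> h; rewrite /P /increasing /= (path_sortedE ltn_trans) all_map.
  by rewrite (inj_eq Some_inj) andbC [X in _ && X]andbC.
case: (z.1 == a) => /=; last by rewrite big_pred0 ?mulr0// => h; rewrite andbF.
under eq_bigr => h _ do rewrite big_cons.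
rewrite -big_distrr/= mulrCA; congr (_ * _).
rewrite -(sum_sort_cells _ _ (fun h => all (fun z' : Q => (z.2 < z'.2)%N) h)).
apply: eq_bigl => g; congr (_ && _); apply: perm_all.
by rewrite perm_sort.
Qed.

Lemma sum_grid_mass : \sum_(z : Q) grid_mass rho z = 1.
Proof.
apply: EFin_inj; rewrite -sumEFin -(@probability_setT _ _ _ rho).
have := @measure_fin_pred _ _ _ rho _ _ xpredT (@measurable_grid_cell R A a0 M).
rewrite (_ : [set _ | _] = setT); last first.
  by apply/seteqP; split.
move=> ->; apply: eq_bigr => z _; rewrite /grid_mass -cell_massE//.
exact: measurable_grid_cell.
Qed.

Lemma mass_after_exp k z : mass_after z ^+ k =
  \sum_(g : k.-tuple Q | all (fun z' : Q => (z.2 < z'.2)%N) g)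
    \prod_(z' <- g) grid_mass rho z'.
Proof.
rewrite /mass_after big_mkcond -sum_tuple_prod [RHS]big_mkcond/=.
apply: eq_bigr => g _; have [/allP gz|/allPn[z' z'g zz']] := ifPn.
  by rewrite big_seq [RHS]big_seq; apply: eq_bigr => z' /gz ->.
by rewrite (big_rem z')//= (negbTE zz') mul0r.
Qed.

(** Dropping the distinctness of the [k] later cells turns the inner sum into
the power [mass_after z ^+ k], at the cost of a collision probability. *)
Lemma first_letter_moment k (a : A) :
  `|\sum_(z : Q | z.1 == a) grid_mass rho z * mass_after z ^+ k -
     (\sum_(u : k.-tuple A) grid_ios M rho [tuple of a :: u]) / k.+1%:R| <=
  1 - distinct_mass M rho k.
Proof.
rewrite sum_grid_ios_first mulrAC divff ?mul1r ?pnatr_eq0//.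
rewrite -sumrB.
apply: le_trans (ler_norm_sum _ _ _) _.
have d0 : 1 - distinct_mass M rho k =
    \sum_(g : k.-tuple Q | ~~ uniq (map (@cell_index A M.+1) g))
      \prod_(z <- g) grid_mass rho z.
  have all1 : \sum_(g : k.-tuple Q) \prod_(z <- g) grid_mass rho z = 1.
    by rewrite sum_tuple_prod sum_grid_mass expr1n.
  rewrite -[X in X - _ = _]all1.
  rewrite (bigID (fun g : k.-tuple Q => uniq (map (@cell_index A M.+1) g)))/=.
  by rewrite /distinct_mass addrAC subrr add0r.
have d1 : 0 <= 1 - distinct_mass M rho k.
  by rewrite d0; apply: sumr_ge0 => g _; apply: prodr_ge0 => z _; exact: grid_mass_ge0.
apply: le_trans (_ : \sum_(z : Q) grid_mass rho z *
   (1 - distinct_mass M rho k) <= _); last first.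
  by rewrite -big_distrl/= sum_grid_mass mul1r.
rewrite [leRHS](bigID (fun z : Q => z.1 == a))/= -[leLHS]addr0.
apply: lerD; last first.
  by apply: sumr_ge0 => z _; rewrite mulr_ge0// grid_mass_ge0.
apply: ler_sum => z _.
rewrite -mulrBr normrM ger0_norm ?grid_mass_ge0// ler_wpM2l ?grid_mass_ge0//.
rewrite mass_after_exp.
rewrite (bigID (fun g : k.-tuple Q => uniq (map (@cell_index A M.+1) g)))/=.
rewrite [X in `|X + _ - _|](eq_bigl (fun g : k.-tuple Q =>
   uniq (map (@cell_index A M.+1) g) && all (fun z' : Q => (z.2 < z'.2)%N) g));
  last by move=> g; rewrite andbC.
rewrite addrAC subrr add0r d0 ger0_norm; last first.
  by apply: sumr_ge0 => g _; apply: prodr_ge0 => ? _; exact: grid_mass_ge0.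
rewrite [leRHS](bigID (fun g : k.-tuple Q => all (fun z' : Q => (z.2 < z'.2)%N) g))/=.
rewrite -[leLHS]addr0; apply: lerD; last first.
  by apply: sumr_ge0 => g _; apply: prodr_ge0 => ? _; exact: grid_mass_ge0.
by rewrite (eq_bigl _ _ (fun g => andbC _ _)).
Qed.

End first_letter.

(** * Bernstein polynomials and counting positions *)

Section bernstein.
Variable R : realType.
Implicit Types (f g : nat -> R) (x : R).

(** [(bern K f).[x]] is the expectation of [f] at a binomial variable with
parameters [K] and [x].  Conditioning on the first trial gives a recursion
under which linearity, positivity and the variance are immediate. *)
Fixpoint bern (K : nat) f : {poly R} :=
  if K is K'.+1 then 'X * bern K' (f \o S) + (1 - 'X) * bern K' f
  else (f 0%N)%:P.

Lemma bern_step K f x : (bern K.+1 f).[x] =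
  x * (bern K (f \o S)).[x] + (1 - x) * (bern K f).[x].
Proof. by rewrite /= !hornerE. Qed.

Lemma bern_le K f g x : 0 <= x <= 1 -> (forall j, f j <= g j) ->
  (bern K f).[x] <= (bern K g).[x].
Proof.
move=> /andP[x0 x1]; elim: K f g => [|K IH] f g fg.
  by rewrite /= !hornerE.
rewrite !bern_step; apply: lerD; apply: ler_wpM2l => //.
- by apply: IH => j /=.
- by rewrite subr_ge0.
- exact: IH.
Qed.

Lemma bern_linear K (c : R) f g x :
  (bern K (fun j => c * f j + g j)).[x] = c * (bern K f).[x] + (bern K g).[x].
Proof.
elim: K f g => [|K IH] f g; first by rewrite /= !hornerE.
rewrite !bern_step IH.
rewrite (_ : (fun j => c * f j + g j) \o S =
  (fun j => c * (f \o S) j + (g \o S) j))// IH; ring.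
Qed.

Lemma bern_cst K (c : R) x : (bern K (fun=> c)).[x] = c.
Proof.
elim: K => [|K IH]; first by rewrite /= !hornerE.
by rewrite bern_step (_ : _ \o _ = fun=> c)// IH; ring.
Qed.

Lemma bern_variance K (c : R) x :
  (bern K (fun j => (j%:R - c) ^+ 2)).[x] =
  (K%:R * x - c) ^+ 2 + K%:R * (x * (1 - x)).
Proof.
elim: K c => [|K IH] c; first by rewrite /= !hornerE; ring.
rewrite bern_step (_ : _ \o _ = fun j => (j%:R - (c - 1)) ^+ 2).
  by rewrite !IH -natr1; ring.
by apply/funext => j /=; rewrite -natr1; ring.
Qed.

(** Chebyshev inequality: [f] is dominated by the squared deviation divided by
[(K%:R * d) ^+ 2], and the variance is at most [K%:R]. *)
Lemma bern_tail K (d : R) f x : 0 < d -> 0 <= x <= 1 -> (0 < K)%N ->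
    (forall j, `|f j| <= 1) ->
    (forall j, `|j%:R - K%:R * x| < K%:R * d -> f j = 0) ->
  `|(bern K f).[x]| <= (K%:R * d ^+ 2)^-1.
Proof.
move=> d0 x01 K0 f1 fd.
have K0' : 0 < K%:R :> R by rewrite ltr0n.
have Kd : 0 < K%:R * d by rewrite mulr_gt0.
pose c := (K%:R * d) ^- 2.
have c0 : 0 <= c by rewrite invr_ge0 exprn_ge0// ltW.
pose h j : R := c * (j%:R - K%:R * x) ^+ 2 + 0.
have fh j : `|f j| <= h j.
  rewrite /h addr0; have [/fd ->|jd] := ltP `|j%:R - K%:R * x| (K%:R * d).
    by rewrite normr0 mulr_ge0// sqr_ge0.
  apply: le_trans (f1 j) _; rewrite mulrC ler_pdivlMr ?exprn_gt0// mul1r.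
  rewrite -[leRHS]real_normK ?num_real//.
  by rewrite lerXn2r ?nnegrE// ltW.
have hb : (bern K h).[x] <= (K%:R * d ^+ 2)^-1.
  rewrite bern_linear bern_variance bern_cst subrr expr0n/= add0r addr0.
  rewrite /c exprMn invfM.
  have /andP[x0 x1] := x01.
  rewrite (_ : _ * _ = (x * (1 - x)) * (K%:R * d ^+ 2)^-1); last first.
    by field; rewrite ?gt_eqF.
  by rewrite ler_piMl ?invr_ge0 ?mulr_ge0 ?sqr_ge0 ?(ltW K0')//; nra.
rewrite ler_norml; apply/andP; split.
  have := @bern_le K (fun j => -1 * h j + 0) f x x01 _.
  rewrite bern_linear bern_cst => H.
  have /H : forall j, -1 * h j + 0 <= f j.
    by move=> j; have := fh j; rewrite ler_norml => /andP[? _]; lra.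
  lra.
apply: le_trans hb; apply: bern_le => // j.
by apply: le_trans (fh j); exact: ler_norm.
Qed.

(** The Bernstein polynomial of a step function is close to the step, except
within [d] of it, where the error is at most [1]. *)
Lemma bern_indicator K (d s : R) x : 0 < d -> 0 <= x <= 1 -> (0 < K)%N ->
  `|((s <= x)%R : nat)%:R - (bern K (fun j => ((K%:R * s <= j%:R)%R : nat)%:R)).[x]| <=
  (K%:R * d ^+ 2)^-1 + ((`|x - s| < d)%R : nat)%:R.
Proof.
move=> d0 x01 K0; set f := fun j => _.
have K0' : 0 < K%:R :> R by rewrite ltr0n.
have i0 : 0 <= (K%:R * d ^+ 2)^-1 by rewrite invr_ge0 mulr_ge0 ?sqr_ge0// ltW.
have -> : ((s <= x)%R : nat)%:R - (bern K f).[x] =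
   - (bern K (fun j => 1 * f j + - ((s <= x)%R : nat)%:R)).[x].
  by rewrite bern_linear bern_cst; ring.
have b01 (b b' : bool) : -1 <= (1 * (b : nat)%:R + - (b' : nat)%:R : R) <= 1.
  by case: b; case: b' => /=; apply/andP; split; lra.
rewrite normrN; case: ltP => xs.
  apply: le_trans (_ : 1 <= _); last by rewrite lerDr.
  rewrite ler_norml; apply/andP; split.
    rewrite -[leLHS](bern_cst K (-1) x); apply: bern_le => // j.
    by have /andP[] := b01 (K%:R * s <= j%:R)%R (s <= x)%R.
  rewrite -[leRHS](bern_cst K 1 x); apply: bern_le => // j.
  by have /andP[] := b01 (K%:R * s <= j%:R)%R (s <= x)%R.
rewrite addr0; apply: bern_tail => // j.
  by rewrite ler_norml; exact: b01.
move: xs; rewrite /f ltr_norml => xs /andP[j1 j2].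
case: (leP s x) => sx.
  rewrite ger0_norm ?subr_ge0// in xs.
  by rewrite (_ : _ <= _ = true)/= ?mul1r ?subrr//; apply/ltW; nra.
rewrite ltr0_norm ?subr_lt0// in xs.
by rewrite (_ : _ <= _ = false)/= ?mulr0 ?subrr//; apply/negbTE; rewrite -ltNge; nra.
Qed.

End bernstein.

Section counting.
Variable R : realType.

Definition pos_count (N : nat) (x : R) : nat :=
  (\sum_(l < N) (l.+1%:R <= x)%R)%N.

Lemma pos_countE N x : pos_count N x = minn (Num.truncn x) N.
Proof.
elim: N => [|N IH]; first by rewrite /pos_count big_ord0 minn0.
rewrite /pos_count big_ord_recr/= -/(pos_count N x) IH.
rewrite -truncn_gt_nat.
by case: (ltngtP N (Num.truncn x)); lia.
Qed.

Lemma pos_count_bounds N x : 0 <= x <= N%:R ->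
  x - 1 <= (pos_count N x)%:R <= x.
Proof.
move=> /andP[x0 xN]; rewrite pos_countE.
have /andP[h1 h2] := truncn_itv x0.
have tN : (Num.truncn x <= N)%N by rewrite -(ler_nat R) (le_trans h1).
by rewrite (minn_idPl tN) h1 andbT; rewrite -natr1 in h2; lra.
Qed.

Lemma pos_count_lip N x y : x <= y ->
  (pos_count N y)%:R <= (pos_count N x)%:R + (y - x) + 1.
Proof.
move=> xy; have [y0|y0] := leP 0 y; last first.
  rewrite !pos_countE (_ : Num.truncn y = 0%N) ?min0n; last first.
    by apply/eqP; rewrite -leqn0 -(truncn0 R) le_truncn// ltW.
  have : 0 <= (minn (Num.truncn x) N)%:R :> R by []. lra.
have py : (pos_count N y)%:R <= y.
  rewrite pos_countE; have /andP[h1 _] := truncn_itv y0.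
  by apply: le_trans h1; rewrite ler_nat geq_minl.
have [x0|x0] := leP 0 x; last first.
  have : 0 <= (pos_count N x)%:R :> R by []. lra.
have [xN|xN] := leP x N%:R.
  have /andP[h _] : x - 1 <= (pos_count N x)%:R <= x.
    by apply: pos_count_bounds; rewrite x0.
  lra.
have -> : pos_count N x = N.
  by rewrite pos_countE; apply/minn_idPr; rewrite truncn_ge_nat// ltW.
have : (pos_count N y)%:R <= N%:R :> R.
  by rewrite pos_countE ler_nat geq_minr.
lra.
Qed.

End counting.

(** * Distribution functions recovered from the densities *)

Lemma card_ord_gt N (l : nat) : #|[pred i : 'I_N | (l < i)%N]| = (N - l.+1)%N.
Proof.
rewrite -sum1_card big_mkcond/=.
rewrite (eq_bigr (fun i : 'I_N => nat_of_bool (l < i)%N)); last first.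
  by move=> i _; rewrite inE; case: ifP.
elim: N => [|N IH]; first by rewrite big_ord0.
by rewrite big_ord_recr/= IH; case: (ltnP l N); lia.
Qed.

Section word_sums.
Variables (R : realType) (A : finType) (a0 : A).
Local Notation T := (letter a0 * R)%type.

(** Integral of [G] under the part of the empirical measure carried by [a]. *)
Definition word_sum (w : word A) (a : A) (G : R -> R) : R :=
  (\sum_(l < size w) (nth a0 w l == a)%:R * G (l.+1%:R / (size w)%:R)) /
    (size w)%:R.

Lemma letter_cdf_word (w : word A) a t :
  letter_cdf (rho_word R a0 w) a t = word_sum w a (fun x => (x <= t)%R%:R).
Proof.
rewrite /letter_cdf (_ : _ `*` _ = [set p : T | (p.1 == a) && (p.2 <= t)]).
  rewrite rho_word_pred [fine _]/= /word_sum natr_sum; congr (_ / _).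
  by apply: eq_bigr => l _ /=; rewrite -mulnb natrM.
apply/seteqP; split => -[b x]/=; rewrite in_itv/=.
  by move=> [-> ->]; rewrite eqxx.
by move=> /andP[/eqP -> ->].
Qed.

Lemma mass_after_word (w : word A) z :
  mass_after (M := (size w).-1) (rho_word R a0 w) z =
  1 - z.2.+1%:R / (size w)%:R.
Proof.
have Nw : (size w).-1.+1 = size w by rewrite prednK// word_gt0.
rewrite /mass_after.
transitivity (\sum_(i : 'I_(size w).-1.+1 | (z.2 < i)%N)
    \sum_b grid_mass (rho_word R a0 w) (b, i)).
  by rewrite exchange_big pair_big/=; apply: eq_bigr; case.
rewrite (eq_bigr (fun=> (size w)%:R^-1)) => [|i _]; last first.
  apply: EFin_inj; rewrite -[in RHS]Nw -(@strip_word R A a0 w i).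
  have := @measure_fin_pred _ _ _ (rho_word R a0 w) _ _ (fun z' => z'.2 == i)
    (@measurable_grid_cell R A a0 (size w).-1).
  rewrite (_ : [set _ | _] = strip i); last first.
    by apply/seteqP; split=> p /eqP.
  move=> ->; rewrite -sumEFin.
  transitivity (\sum_b \sum_(j | j == i) (grid_mass (rho_word R a0 w) (b, j))%:E)%E.
    by apply: eq_bigr => b _; rewrite big_pred1_eq.
  rewrite pair_big/=; apply: eq_bigr => -[b j] _.
  by rewrite /grid_mass -cell_massE//; exact: measurable_grid_cell.
rewrite sumr_const -[_ *+ _]mulr_natl.
have -> : #|[pred i : 'I_(size w).-1.+1 | (z.2 < i)%N]| = (size w - z.2.+1)%N.
  by rewrite card_ord_gt [X in (X - _)%N = _]Nw.
rewrite natrB; last by rewrite -[X in (_ <= X)%N]Nw ltn_ord.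
by rewrite mulrBl divff// pnatr_eq0 -lt0n word_gt0.
Qed.

Lemma sum_grid_mass_word (w : word A) a (G : R -> R) :
  \sum_(z : A * 'I_(size w).-1.+1 | z.1 == a) grid_mass (rho_word R a0 w) z *
     G (z.2.+1%:R / (size w)%:R) = word_sum w a G.
Proof.
transitivity (\sum_(b | b == a) \sum_(i < (size w).-1.+1)
    (nth a0 w i == b)%:R * G (i.+1%:R / (size w)%:R) / (size w)%:R).
  rewrite pair_big/=; apply: eq_big => [z|z _]; first by rewrite andbT.
  by rewrite grid_mass_word mulrAC.
by rewrite big_pred1_eq -big_distrl/=; case: w => -[].
Qed.

Lemma word_moment (w : word A) a k : (k < size w)%N ->
  `|word_sum w a (fun x => (1 - x) ^+ k) -
    ffact_ratio R (size w) k.+1 / k.+1%:R *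
      \sum_(u : k.-tuple A) ssd R (a :: u) w| <= 1 - ffact_ratio R (size w) k.
Proof.
move=> kw; have := @first_letter_moment R A a0 (size w).-1 (rho_word R a0 w) k a.
rewrite distinct_mass_uniform; last exact: strip_word.
rewrite [X in _ - ffact_ratio _ X _]prednK ?word_gt0//.
have -> : \sum_(z : A * 'I_(size w).-1.+1 | z.1 == a)
    grid_mass (rho_word R a0 w) z * mass_after (rho_word R a0 w) z ^+ k =
    word_sum w a (fun x => (1 - x) ^+ k).
  by rewrite -sum_grid_mass_word; apply: eq_bigr => z _; rewrite mass_after_word.
move=> H; apply: le_trans H; rewrite le_eqVlt; apply/orP; left.
apply/eqP; congr (`|_ - _|); rewrite mulrAC big_distrr/=; congr (_ / _).
apply: eq_bigr => u _.
by rewrite grid_ios_word_tuple.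
Qed.

End word_sums.

Section cdf_limits.
Variables (R : realType) (A : finType) (a0 : A).

Lemma word_pos_count (w : word A) (t : R) :
  \sum_(l < size w) ((l.+1%:R / (size w)%:R <= t)%R : nat)%:R =
  (pos_count (size w) ((size w)%:R * t))%:R :> R.
Proof.
rewrite /pos_count natr_sum; apply: eq_bigr => l _.
by rewrite ler_pdivrMr ?ltr0n ?word_gt0// mulrC.
Qed.

(** Positions are equally spaced, so at most [2 * d * N + 1] of them lie within
[d] of [t]. *)
Lemma word_sum_dist (w : word A) a (G H : R -> R) (e d t : R) :
    0 <= d ->
    (forall x, 0 <= x <= 1 -> `|G x - H x| <= e + ((`|x - t| < d)%R : nat)%:R) ->
  `|word_sum a0 w a G - word_sum a0 w a H| <= e + 2 * d + (size w)%:R^-1.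
Proof.
move=> d0 GH; have N0 : 0 < (size w)%:R :> R by rewrite ltr0n word_gt0.
rewrite /word_sum -mulrBl -sumrB normrM [X in _ * X]ger0_norm ?invr_ge0 ?(ltW N0)//.
rewrite ler_pdivrMr//.
apply: le_trans (ler_norm_sum _ _ _) _.
apply: le_trans (_ : \sum_(l < size w) (e +
  (((l.+1%:R / (size w)%:R <= t + d)%R : nat)%:R -
   ((l.+1%:R / (size w)%:R <= t - d)%R : nat)%:R)) <= _).
  apply: ler_sum => l _; rewrite -mulrBr normrM.
  have x01 : 0 <= (l.+1%:R / (size w)%:R : R) <= 1.
    by rewrite divr_ge0//= ler_pdivrMr// mul1r ler_nat ltn_ord.
  apply: le_trans (_ : `|G (l.+1%:R / (size w)%:R) - H (l.+1%:R / (size w)%:R)| <= _).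
    by rewrite ler_piMl// ger0_norm//; case: (_ == _).
  apply: le_trans (GH _ x01) _; rewrite lerD2l; set x := _ / _.
  have [xd|xd] := ltP; last first.
    rewrite subr_ge0 ler_nat; case: (leP x (t - d)) => // h.
    by rewrite (_ : x <= t + d)//; lra.
  move: xd; rewrite ltr_norml => /andP[h1 h2].
  have -> : (x <= t + d) = true by lra.
  have -> : (x <= t - d) = false by apply/negbTE; rewrite -ltNge; lra.
  by rewrite subr0.
rewrite big_split/= sumrB !word_pos_count sumr_const card_ord -[_ *+ _]mulr_natr.
have := @pos_count_lip R (size w) ((size w)%:R * (t - d)) ((size w)%:R * (t + d)).
rewrite ler_pM2l// => /(_ _) H1.
have /H1 H2 : t - d <= t + d by lra.
rewrite mulrDl mulVf ?gt_eqF// mulrDl; lra.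
Qed.

Variable w : nat -> word A.
Hypothesis w_infty : size (w n) @[n --> \oo] --> \oo.

Lemma inv_size_small (e : R) : 0 < e -> \forall n \near \oo, (size (w n))%:R^-1 <= e.
Proof.
move=> e0; near=> n.
have h : e^-1 <= (size (w n))%:R.
  have : (Num.truncn e^-1).+1%:R <= (size (w n))%:R :> R.
    rewrite ler_nat; near: n.
    by have /cvgnyPge := w_infty; apply.
  by apply: le_trans; rewrite ltW// truncnS_gt.
by rewrite invf_ple ?posrE// ltr0n word_gt0.
Unshelve. all: by end_near. Qed.

Hypothesis ssd_is_cvg : forall v : word A, cvg (ssd R v (w n) @[n --> \oo]).

Lemma word_moment_is_cvg a k :
  cvg (word_sum a0 (w n) a (fun x : R => (1 - x) ^+ k) @[n --> \oo]).
Proof.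
apply: approx_is_cvg => e e0.
exists (fun n => ffact_ratio R (size (w n)) k.+1 / k.+1%:R *
      \sum_(u : k.-tuple A) ssd R (a :: u) (w n)); split.
  apply: is_cvgM.
    by apply: is_cvgM; [apply: cvgP (ffact_ratio_cvg _ w_infty)|exact: is_cvg_cst].
  pose l (u : k.-tuple A) := limn (fun n => ssd R (a :: u) (w n)).
  suff : \sum_(u : k.-tuple A) ssd R (a :: u) (w n) @[n --> \oo] --> \sum_u l u.
    exact: cvgP.
  apply: cvg_big => [|u _]; first exact: add_continuous.
  exact: (@ssd_is_cvg (@Word A (a :: u) isT)).
have /cvgrPdist_le/(_ _ e0) rn := @ffact_ratio_cvg R _ k w_infty.
near=> n.
have kw : (k < size (w n))%N by near: n; have /cvgnyPge := w_infty; apply.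
apply: le_trans (@word_moment R A a0 _ a k kw) _.
apply: le_trans (ler_norm _) _; near: n; exact: rn.
Unshelve. all: by end_near. Qed.

Lemma word_poly_is_cvg a (p : {poly R}) :
  cvg (word_sum a0 (w n) a (fun x => p.[1 - x]) @[n --> \oo]).
Proof.
have -> : (fun n => word_sum a0 (w n) a (fun x => p.[1 - x])) =
    (fun n => \sum_(i < size p) p`_i * word_sum a0 (w n) a (fun x => (1 - x) ^+ i)).
  apply/funext => n; rewrite /word_sum.
  under [RHS]eq_bigr do rewrite mulrA big_distrr/=.
  rewrite -big_distrl/= exchange_big/=; congr (_ / _); apply: eq_bigr => l _.
  rewrite horner_coef big_distrr/=; apply: eq_bigr => i _; ring.
pose l (i : 'I_(size p)) :=
  p`_i * limn (fun n => word_sum a0 (w n) a (fun x => (1 - x) ^+ i)).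
suff : \sum_(i < size p) p`_i * word_sum a0 (w n) a (fun x => (1 - x) ^+ i)
    @[n --> \oo] --> \sum_i l i by exact: cvgP.
apply: cvg_big => [|i _]; first exact: add_continuous.
by apply: cvgMl_tmp; exact: word_moment_is_cvg.
Qed.

(** The step at [t] in the variable [x] is a step at [1 - t] in the variable
[1 - x], whose moments are known to converge. *)
Lemma letter_cdf_is_cvg a t :
  cvg (letter_cdf (rho_word R a0 (w n)) a t @[n --> \oo]).
Proof.
apply: approx_is_cvg => e e0.
  (* The three errors are at most [d] for the binomial tail, [2 * d] for the
     positions near [t], and [d] for rounding. *)
pose d := e / 8; have d0 : 0 < d by rewrite divr_gt0.
pose K := (Num.truncn (d ^+ 2 * d)^-1).+1.
have Kd : (K%:R * d ^+ 2)^-1 <= d.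
  rewrite invfM ler_pdivrMr ?exprn_gt0// invf_ple ?posrE ?ltr0n ?mulr_gt0 ?exprn_gt0//.
  by rewrite mulrC ltW// truncnS_gt.
pose p : {poly R} := bern K (fun j => ((K%:R * (1 - t) <= j%:R)%R : nat)%:R).
exists (fun n => word_sum a0 (w n) a (fun x => p.[1 - x])); split.
  exact: word_poly_is_cvg.
have d4 := inv_size_small d0.
near=> n; rewrite letter_cdf_word.
have H : forall x, 0 <= x <= 1 -> `|((x <= t)%R : nat)%:R - p.[1 - x]| <=
    (K%:R * d ^+ 2)^-1 + ((`|x - t| < d)%R : nat)%:R.
  move=> x /andP[x0 x1].
  have x01 : 0 <= 1 - x <= 1 by apply/andP; split; lra.
  have := @bern_indicator R K d (1 - t) (1 - x) d0 x01 isT.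
  rewrite (_ : (1 - t <= 1 - x) = (x <= t)); last by rewrite lerD2l lerN2.
  by rewrite (_ : 1 - x - (1 - t) = t - x) ?[`|t - x|]distrC//; ring.
apply: le_trans (word_sum_dist _ _ (ltW d0) H) _.
have : (size (w n))%:R^-1 <= d by near: n.
rewrite /d in Kd *; lra.
Unshelve. all: by end_near. Qed.

End cdf_limits.

(** * The limit measure *)

Section stieltjes.
Variable R : realType.

Lemma stieltjes_oc (f : cumulative R R) s t : s <= t ->
  lebesgue_stieltjes_measure f `]s, t]%classic = (f t - f s)%:E.
Proof.
move=> st; rewrite /lebesgue_stieltjes_measure /measure_extension.
by rewrite measurable_mu_extE/= ?wlength_itv_bnd//; exact: is_ocitv.
Qed.

(** A Lipschitz function is right-continuous, and its Lebesgue-Stieltjes measure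
is finite since the function is constant outside the unit interval. *)
Lemma exists_stieltjes (F : R -> R) :
    {homo F : x y / x <= y} -> (forall x y, x <= y -> F y - F x <= y - x) ->
    (forall x, x <= 0 -> F x = 0) -> (forall x, 1 <= x -> F x = F 1) ->
  exists mu : {measure set (measurableTypeR R) -> \bar R},
    (forall s t, s <= t -> mu `]s, t]%classic = (F t - F s)%:E) /\
    mu setT = (F 1)%:E.
Proof.
move=> Fnd Flip F0 F1.
have Frc : right_continuous F.
  move=> x; apply/cvgrPdist_le => e e0; near=> y.
  have xy : x <= y by near: y; exact: nbhs_right_ge.
  have yx : y <= x + e by near: y; apply: nbhs_right_le; rewrite ltrDl.
  have h1 := Fnd _ _ xy; have h2 := Flip _ _ xy.
  by rewrite ler_norml; apply/andP; split; lra.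
pose f : cumulative R R := HB.pack F (isCumulative.Build R _ R F Fnd Frc).
pose mu : {measure set (measurableTypeR R) -> \bar R} := lebesgue_stieltjes_measure f.
have muE s t : s <= t -> mu `]s, t]%classic = (F t - F s)%:E.
  exact: (stieltjes_oc f).
exists mu; split=> //.
pose I n : set R := `]- (n%:R), n%:R]%classic.
have muI : mu (I n) @[n --> \oo] --> (F 1)%:E.
  apply: cvg_near_cst; near=> n.
  have n1 : (1 <= n)%N by near: n; exact: nbhs_infty_ge.
  have n0 : 0 <= n%:R :> R by [].
  rewrite /I muE; last by lra.
  by rewrite (F1 n%:R) ?ler1n// (F0 (- _)) ?subr0//; lra.
have : mu (I n) @[n --> \oo] --> mu (\bigcup_n I n).
  apply: nondecreasing_cvg_mu; rewrite /I//; first exact: bigcup_measurable.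
  by move=> *; apply/subsetPset/subset_itv; rewrite leBSide/= ?lerN2 ler_nat.
rewrite bigcup_itvT => muT; exact: cvg_unique muT muI.
Unshelve. all: by end_near. Qed.

End stieltjes.

Section letter_embedding.
Variables (R : realType) (A : finType) (a0 : A).

Definition letter_embed (a : A) (x : measurableTypeR R) : letter a0 * R := (a, x).

Lemma measurable_letter_embed a : measurable_fun setT (letter_embed a).
Proof.
by apply: measurable_fun_pair; [exact: measurable_cst|exact: measurable_id].
Qed.

(** One Lebesgue-Stieltjes measure on each copy of the line. *)
Lemma exists_letter_measure (F : A -> R -> R) :
    (forall a, {homo F a : x y / x <= y}) ->
    (forall a x y, x <= y -> F a y - F a x <= y - x) ->
    (forall a x, x <= 0 -> F a x = 0) ->
    (forall a x, 1 <= x -> F a x = F a 1) ->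
    \sum_a F a 1 = 1 ->
  exists rho : probability (letter a0 * R)%type R,
    forall (B : set (letter a0)) s t, s <= t ->
      rho (B `*` `]s, t]%classic) = (\sum_(a : A | `[< B a >]) (F a t - F a s))%:E.
Proof.
move=> Fnd Flip F0 F1 Fsum.
have /boolp.choice[mu muP] a := exists_stieltjes (Fnd a) (Flip a) (F0 a) (F1 a).
pose nu0 : {measure set (letter a0 * R)%type -> \bar R} :=
  msum (fun i => pushforward (mu (nth a0 (enum A) i))
                   (letter_embed (nth a0 (enum A) i))) #|A|.
pose nu := nu0 (fun i => measurable_letter_embed (nth a0 (enum A) i)).
have nuE B : nu B = (\sum_a mu a (letter_embed a @^-1` B))%E.
  by rewrite -big_enum (big_nth a0) big_mkord -cardE.
have nuT : nu setT = 1%E.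
  rewrite nuE -Fsum -sumEFin; apply: eq_bigr => a _.
  by rewrite preimage_setT (muP a).2.
(* The total mass is already [1]: normalizing only packages the measure as a
   probability, and [dirac point] is never reached. *)
exists (mnormalize nu (dirac point)) => B s t st.
rewrite [LHS]/(mnormalize _ _ _) /mnormalize nuT onee_eq0/= invr1 mule1 nuE.
rewrite [in RHS]big_mkcond -sumEFin; apply: eq_bigr => a _.
case: asboolP => Ba.
  rewrite -(muP a).1//; congr (mu a _).
  by apply/seteqP; split => x /=; [case|].
by rewrite (_ : _ @^-1` _ = set0) ?measure0//; apply/seteqP; split => x //= [].
Qed.

End letter_embedding.

Section limit_measure.
Variables (R : realType) (A : finType) (a0 : A) (w : nat -> word A).
Hypothesis w_infty : size (w n) @[n --> \oo] --> \oo.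
Hypothesis cdf_is_cvg : forall a t,
  cvg (letter_cdf (rho_word R a0 (w n)) a t @[n --> \oo]).

Lemma letter_cdf_word_lip (v : word A) a (x y : R) : x <= y ->
  letter_cdf (rho_word R a0 v) a y - letter_cdf (rho_word R a0 v) a x <=
  y - x + (size v)%:R^-1.
Proof.
move=> xy; have N0 : 0 < (size v)%:R :> R by rewrite ltr0n word_gt0.
rewrite !letter_cdf_word /word_sum -mulrBl -sumrB ler_pdivrMr//.
apply: le_trans (_ : \sum_(l < size v)
    (((l.+1%:R / (size v)%:R <= y)%R : nat)%:R -
     ((l.+1%:R / (size v)%:R <= x)%R : nat)%:R) <= _).
  apply: ler_sum => l _; rewrite -mulrBr; set z := _ / _.
  have : 0 <= ((z <= y)%R : nat)%:R - ((z <= x)%R : nat)%:R :> R.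
    by rewrite subr_ge0 ler_nat; case: (leP z x) => // /le_trans ->.
  by case: (_ == _); rewrite ?mul1r// mul0r.
rewrite sumrB !word_pos_count.
have := @pos_count_lip R (size v) ((size v)%:R * x) ((size v)%:R * y).
rewrite ler_pM2l// => /(_ xy).
rewrite mulrDl mulVf ?gt_eqF// mulrBl; lra.
Qed.

Lemma sum_letter_cdf_word (v : word A) (t : R) : 0 <= t <= 1 ->
  `|t - \sum_a letter_cdf (rho_word R a0 v) a t| <= (size v)%:R^-1.
Proof.
move=> /andP[t0 t1]; have N0 : 0 < (size v)%:R :> R by rewrite ltr0n word_gt0.
have -> : \sum_a letter_cdf (rho_word R a0 v) a t =
    (pos_count (size v) ((size v)%:R * t))%:R / (size v)%:R.
  under eq_bigr do rewrite letter_cdf_word.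
  rewrite /word_sum -big_distrl/= exchange_big/= -word_pos_count; congr (_ / _).
  apply: eq_bigr => l _; rewrite -big_distrl/= (bigD1 (nth a0 v l))//= eqxx.
  by rewrite big1 ?addr0 ?mul1r// => a /negbTE; rewrite eq_sym => ->.
have /pos_count_bounds/andP[h1 h2] : 0 <= (size v)%:R * t <= (size v)%:R.
  by rewrite mulr_ge0//= ler_piMr// ltW.
rewrite -(@ler_pM2l _ (size v)%:R)// divff ?gt_eqF//.
rewrite -[X in X * `|_|]ger0_norm ?(ltW N0)// -normrM mulrBr.
rewrite mulrCA divff ?gt_eqF// mulr1.
by rewrite ler_norml; apply/andP; split; lra.
Qed.

(** The properties required of the limits pass from the empirical distribution
functions, which satisfy them up to the inverse of the length of the word. *)
Lemma exists_cdf_limit : exists2 rho : probability (letter a0 * R)%type R,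
  calC rho & cdf_cvg w rho.
Proof.
pose F a t := limn (fun n => letter_cdf (rho_word R a0 (w n)) a t).
have FE a t : letter_cdf (rho_word R a0 (w n)) a t @[n --> \oo] --> F a t.
  exact: cdf_is_cvg.
have Fnd a : {homo F a : x y / x <= y}.
  move=> x y xy; apply: ler_lim => //; apply: nearW => n.
  exact: letter_cdf_homo.
have N0 : (size (w n))%:R^-1 @[n --> \oo] --> (0 : R).
  apply/cvgrPdist_le => e e0; have := inv_size_small w_infty e0.
  apply: filterS => n ne; rewrite sub0r normrN ger0_norm ?invr_ge0//.
have Flip a x y : x <= y -> F a y - F a x <= y - x.
  move=> xy; rewrite -[leRHS]addr0; apply: ler_cvg_to (cvgB (FE a y) (FE a x))
    (cvgD (cvg_cst (y - x)) N0) _.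
  by apply: nearW => n; exact: letter_cdf_word_lip.
have F0 a x : x <= 0 -> F a x = 0.
  move=> x0; apply: (@cvg_unique _ (@Rhausdorff R) _ _ _ _ (FE a x)).
  apply: cvg_near_cst; apply: nearW => n.
  rewrite letter_cdf_word /word_sum big1 ?mul0r// => l _.
  rewrite (_ : _ <= x = false) ?mulr0//; apply/negbTE; rewrite -ltNge.
  by rewrite (le_lt_trans x0)// divr_gt0// ltr0n word_gt0.
have F1 a x : 1 <= x -> F a x = F a 1.
  move=> x1; congr (limn _); apply/funext => n.
  rewrite !letter_cdf_word /word_sum; congr (_ / _); apply: eq_bigr => l _.
  have l1 : l.+1%:R / (size (w n))%:R <= 1 :> R.
    by rewrite ler_pdivrMr ?ltr0n ?word_gt0// mul1r ler_nat ltn_ord.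
  by rewrite l1 (le_trans l1 x1).
have Fsum t : 0 <= t <= 1 -> \sum_a F a t = t.
  move=> t01.
  have h1 : \sum_a letter_cdf (rho_word R a0 (w n)) a t @[n --> \oo] --> \sum_a F a t.
    by apply: cvg_big => [|a _]; [exact: add_continuous|exact: FE].
  apply: (@cvg_unique _ (@Rhausdorff R) _ _ _ _ h1).
  apply/cvgrPdist_le => e e0; have := inv_size_small w_infty e0.
  apply: filterS => n; apply: le_trans; exact: sum_letter_cdf_word.
have Fsum1 : \sum_a F a 1 = 1 by apply: Fsum; rewrite ler01 lexx.
have [rho rhoE] := exists_letter_measure a0 Fnd Flip F0 F1 Fsum1.
(* Distribution functions measure half-open intervals only: the closed interval
   from [0] to [t] is squeezed between two of them. *)
have rhoT s t : s <= t -> s <= 0 -> 0 <= t <= 1 ->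
    rho ([set: letter a0] `*` `]s, t]%classic) = t%:E.
  move=> st s0 t01; rewrite rhoE// -[in RHS](Fsum t t01); congr EFin.
  rewrite [LHS](eq_bigl xpredT); last by move=> a; exact/asboolP.
  by apply: eq_bigr => a _; rewrite (F0 _ _ s0) subr0.
have rhoC : calC rho.
  move=> t /andP[t0 t1]; apply/eqP; rewrite eq_le; apply/andP; split.
    rewrite -(rhoT (-1) t); [|lra|lra|by rewrite t0].
    apply: le_measure; rewrite ?inE; [exact: measurable_letterX..|].
    by move=> [b x]/= []; rewrite !in_itv/= => _ /andP[x0 ->]; split=> //; lra.
  rewrite -(rhoT 0 t); [|by []|by []|by rewrite t0].
  apply: le_measure; rewrite ?inE;
    [exact: measurable_letterX..|].
  by move=> [b x]/= []; rewrite !in_itv/= => _ /andP[/ltW -> ->].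
exists rho => // a t /andP[t0 t1].
have -> : letter_cdf rho a t = F a t; last exact: FE.
have c0 : letter_cdf rho a 0 = 0.
  rewrite /letter_cdf supportedI; [|exact: calC_supported|exact: measurable_letterX].
  rewrite (_ : _ `&` _ = set0) ?measure0//; apply/seteqP; split => -[b x] //=.
  by rewrite !in_itv/= => -[[_ x0] [_ /andP[]]]; rewrite ltNge x0.
have := letter_cdf_oc rho a t0; rewrite c0 subr0 rhoE// => -[<-].
rewrite (big_pred1 a) => [|b]; first by rewrite (F0 _ 0)// subr0.
by apply/asboolP/eqP.
Qed.

End limit_measure.

(** * The equivalence *)

Theorem corollary4 (R : realType) (A : finType) (a0 : A) (w : nat -> word A)
  (w_infty : size (w n) @[n --> \oo] --> \oo) :
  ((forall v : word A, cvg (ssd R v (w n) @[n --> \oo])) <->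
   (exists2 rho : probability (letter a0 * R)%type R,
      calC rho & weak_cvg (fun n => rho_word R a0 (w n)) rho)) /\
  (forall rho : probability (letter a0 * R)%type R,
     calC rho -> weak_cvg (fun n => rho_word R a0 (w n)) rho ->
     forall (k : nat) (v : k.-tuple A), (1 <= k)%N ->
       ssd R v (w n) @[n --> \oo] --> fine (IOS k rho [set v])).
Proof.
have limE (rho : probability (letter a0 * R)%type R) : calC rho ->
    weak_cvg (fun n => rho_word R a0 (w n)) rho ->
    forall k (v : k.-tuple A),
      ssd R v (w n) @[n --> \oo] --> fine (IOS k rho [set v]).
  by move=> rhoC /(weak_cdf_cvg rhoC) rho_cdf k v; exact: ssd_cvg.
split=> [|rho rhoC rho_weak k v _]; last exact: limE.
split=> [ssd_is_cvg|[rho rhoC rho_weak] v].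
  have [rho rhoC rho_cdf] := exists_cdf_limit w_infty
    (@letter_cdf_is_cvg R A a0 w w_infty ssd_is_cvg).
  by exists rho => //; exact: cdf_weak_cvg.
exact: cvgP (limE rho rhoC rho_weak _ (in_tuple v)).
Qed.
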